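(* Let $\alpha>0$ and let $X_1,X_2,\ldots$ be independent and identically distributed with the Pareto distribution $P(\alpha)$. For $n\ge 1$ let $\hat\alpha_n=n\big/\sum_{i=1}^n\log X_i$ and $$\mathscr{DS}_1=\frac{\hat\alpha_n+1}{n}\sum_{i=1}^n\frac{\log X_i}{X_i}-\frac1n\sum_{i=1}^n\frac1{X_i}.$$ Then, as $n\to\infty$, $\sqrt n\,\mathscr{DS}_1$ converges in distribution to the normal distribution $N(0,\sigma^2)$, where $$\sigma^2=\frac{\alpha\left[2+(2\alpha+\alpha^2)(5+8\alpha+4\alpha^2)\right]}{(2+\alpha)^3(1+\alpha)^4}.$$
   Context: For $\alpha>0$, $P(\alpha)$ denotes the Pareto distribution with shape $\alpha$ and scale $1$, i.e. the distribution with density $\alpha x^{-\alpha-1}$ for $x\ge 1$ and $0$ for $x<1$. The estimator $\hat\alpha_n$ is the maximum likelihood estimator of $\alpha$ (almost surely well defined, since $X_i>1$ almost surely). *)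

(* Defs.v *)
From HB Require Import structures.
From mathcomp Require Import all_boot all_order all_algebra.
From mathcomp Require Import finmap.
From mathcomp Require Import all_classical all_reals all_analysis.
From mathcomp Require Import measurable_realfun.

Set Implicit Arguments.
Unset Strict Implicit.
Unset Printing Implicit Defensive.

Import Order.TTheory GRing.Theory Num.Theory.
Import numFieldNormedType.Exports.

Local Open Scope classical_set_scope.
Local Open Scope ring_scope.

Section pareto.
Context {R : realType}.

Definition pareto_pdf (alpha : R) : R -> R :=
  (fun x => alpha * x `^ (- alpha - 1)) \_ `[1, +oo[.

Definition pareto_prob (alpha : R) : set R -> \bar R := fun A =>
  (\int[lebesgue_measure]_(x in A) (pareto_pdf alpha x)%:E)%E.

End pareto.

Section probability_notions.
Context d (T : measurableType d) (R : realType) (P : probability T R).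

Definition mutually_independent (I : choiceType) (X : I -> {RV P >-> R}) :=
  forall (J : {fset I}) (A : I -> set R), (forall i, measurable (A i)) ->
    P (\bigcap_(i in [set` J]) X i @^-1` A i) =
    (\prod_(i <- J) P (X i @^-1` A i))%E.

(* The distribution functions converge at every continuity point of the limit's
   distribution function. *)
Definition cvg_in_distribution (Z : nat -> {RV P >-> R})
    (mu : probability (measurableTypeR R) R) :=
  forall x : R, {for x, continuous (fun r : R => mu `]-oo, r]%classic)} ->
    cdf (Z n) x @[n --> \oo] --> mu `]-oo, x]%classic.

End probability_notions.

Arguments mutually_independent {d T R} P {I} X.
Arguments cvg_in_distribution {d T R} P Z mu.

Section statistics.
Context {R : realType} (n : nat).
Implicit Type x : 'I_n -> R.

(* Closed form of the maximum likelihood estimator of the shape; when all the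
   observations equal 1 (a null event) the division by 0 returns 0. *)
Definition pareto_mle x : R := n%:R / \sum_(i < n) ln (x i).

Definition DS1 x : R :=
  (pareto_mle x + 1) / n%:R * \sum_(i < n) (ln (x i) / x i) -
  n%:R^-1 * \sum_(i < n) (x i)^-1.

End statistics.

Section scaled_statistic.
Context d (T : measurableType d) (R : realType).

Definition sqrtn_DS1 (X : nat -> {mfun T >-> R}) (n : nat) : T -> R :=
  fun w => Num.sqrt n%:R * DS1 (fun i : 'I_n => X i w).

Lemma measurable_invr : measurable_fun [set: R] (fun x : R => x^-1).
Proof.
have -> : [set: R] = [set 0] `|` ~` [set 0] by rewrite setUv.
apply/measurable_funU => //; first exact: measurableC.
split; first exact: measurable_fun_set1.
apply: open_continuous_measurable_fun.
  exact: (closed_openC (@closed_eq R 0)).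
by move=> x; rewrite inE/= => /eqP x0; exact: inv_continuous.
Qed.

Lemma measurable_sqrtn_DS1 (X : nat -> {mfun T >-> R}) (n : nat) :
  measurable_fun [set: T] (sqrtn_DS1 X n).
Proof.
have mV (f : T -> R) : measurable_fun setT f ->
    measurable_fun setT (fun w => (f w)^-1).
  by move=> mf; exact: (measurableT_comp measurable_invr).
have mX i : measurable_fun [set: T] (X i) by [].
have mL i : measurable_fun [set: T] (fun w => ln (X i w)).
  exact: (measurableT_comp (@measurable_ln R)).
apply: measurable_funM => //; apply: measurable_funB.
  apply: measurable_funM.
    apply: measurable_funM => //; apply: measurable_funD => //.
    apply: measurable_funM => //; apply: mV.
    by apply: measurable_sum => i; exact: mL.
  apply: measurable_sum => i; apply: measurable_funM; first exact: mL.
  by apply: mV; exact: mX.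
apply: measurable_funM => //; apply: measurable_sum => i.
by apply: mV; exact: mX.
Qed.

HB.instance Definition _ (X : nat -> {mfun T >-> R}) (n : nat) :=
  isMeasurableFun.Build _ _ _ _ (sqrtn_DS1 X n) (measurable_sqrtn_DS1 X n).

End scaled_statistic.

(* Main.v *)
From HB Require Import structures.
Require Import Defs.
From mathcomp Require Import all_boot all_order all_algebra.
From mathcomp Require Import finmap ring lra.
From mathcomp Require Import all_classical all_reals all_analysis.
From mathcomp Require Import measurable_realfun.

(* Writing L, M for the sample means of ln X and ln X / X, and m for the mean of
   ln X / X, the statistic differs from the sample mean of a centred influence
   function f (X i) by the exact product
     (1 - alpha L) / L * ((M - m) + m (1 - alpha L)),
   which Chebyshev's inequality shows to be o(n^(-1/2)) in probability. It
   remains to prove the central limit theorem for f (X i), by Lindeberg's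
   replacement argument. The indicator of a half-line is smoothed into
   Phi ((a - .) / sqrt s), with Phi the standard normal distribution function;
   since these functions solve the heat equation, adding one summand to the
   partial sum amounts, up to an error O(n^(-3/2)), to increasing s by the
   variance of the summand. This replaces all the summands without introducing
   Gaussian random variables. *)

Set Implicit Arguments.
Unset Strict Implicit.
Unset Printing Implicit Defensive.

Import Order.TTheory GRing.Theory Num.Theory.
Import numFieldNormedType.Exports.

Local Open Scope classical_set_scope.
Local Open Scope ring_scope.

(** * Taylor estimates for the normal distribution function *)

Section taylor.
Context {R : realType}.
Implicit Types (D : set R) (f : R -> R).

(** The space [T] is arbitrary and need not carry normal variables independent of [X], so summands
    cannot simply be exchanged for Gaussian ones. The width [eps] of the smoothing stays fixed while
    [n] grows: with [s = n * eps ^+ 2] the [n] replacements cost O(n^(-1/2)) in total, and [eps]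
    tends to 0 only afterwards. The linearization error is absorbed when the indicator is compared
    with its shifted smoothings, so convergence of the linear part and passage to the statistic are
    one argument. The product in the linearization is quadratic in the deviations because
    [influence] comes from the delta method: the slope in L of (1 / L + 1) M at the means is -
    alpha^2 m = - alpha^3 / (alpha + 1)^2. *)

Lemma MVT_interval D f df (x y : R) : is_interval D ->
  (forall t, D t -> is_derive t 1 f (df t)) -> D x -> D y ->
  exists c, [/\ D c, `|c - x| <= `|y - x| & f y - f x = df c * (y - x)].
Proof.
move=> iD fD Dx Dy.
have main a b : a <= b -> D a -> D b ->
    exists2 c, a <= c <= b & f b - f a = df c * (b - a).
  move=> ab Da Db.
  have Dab t : t \in `[a, b] -> D t by rewrite in_itv/=; exact: iD.
  have [||c] := @MVT_segment _ f df _ _ ab.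
  - by move=> t tab; apply: fD; apply: Dab; exact: subset_itv_oo_cc tab.
  - apply: derivable_within_continuous => t /Dab /fD [] //.
  by rewrite in_itv/= => cab E; exists c.
have [xy|/ltW yx] := leP x y.
  have [c cxy E] := main _ _ xy Dx Dy; exists c; split => //.
    exact: (iD _ _ Dx Dy).
  by case/andP: cxy => ? ?; rewrite !ger0_norm; lra.
have [c cxy E] := main _ _ yx Dy Dx; exists c; split.
- exact: (iD _ _ Dy Dx).
- by case/andP: cxy => ? ?; rewrite !ler0_norm; lra.
- by rewrite -opprB E; ring.
Qed.

(** Two uses of the mean value theorem; the factor 1/2 of the Lagrange remainder is given up, only
    the order being of interest. For expansions in the time variable [D] is a half-line. *)
Lemma taylor1 D f f1 f2 (M x y : R) : is_interval D ->
  (forall t, D t -> is_derive t 1 f (f1 t)) ->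
  (forall t, D t -> is_derive t 1 f1 (f2 t)) ->
  (forall t, D t -> `|f2 t| <= M) -> D x -> D y ->
  `|f y - f x - (y - x) * f1 x| <= M * (y - x) ^+ 2.
Proof.
move=> iD ff1 f12 f2M Dx Dy.
have [c [Dc cxy ->]] := MVT_interval iD ff1 Dx Dy.
have [e [De _ E]] := MVT_interval iD f12 Dx Dc.
have -> : f1 c * (y - x) - (y - x) * f1 x = (f1 c - f1 x) * (y - x) by ring.
rewrite E !normrM -(real_normK (num_real (y - x))) expr2 mulrA.
by rewrite ler_wpM2r// ler_pM// f2M.
Qed.

(** Up to a constant, [g] is [f] minus its quadratic Taylor polynomial; its derivative [g1] is the
    first-order remainder of [f1], to which [taylor1] applies. *)
Lemma taylor2 f f1 f2 f3 (M x w : R) :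
  (forall t : R, is_derive t 1 f (f1 t)) ->
  (forall t : R, is_derive t 1 f1 (f2 t)) ->
  (forall t : R, is_derive t 1 f2 (f3 t)) -> (forall t, `|f3 t| <= M) ->
  `|f (x + w) - f x - w * f1 x - w ^+ 2 / 2 * f2 x| <= M * `|w| ^+ 3.
Proof.
move=> ff1 f12 f23 f3M; set y := x + w.
pose g t := f t - (t - x) * f1 x - (t - x) ^+ 2 / 2 * f2 x.
pose g1 t := f1 t - f1 x - (t - x) * f2 x.
have gg1 (t : R) : setT t -> is_derive t 1 g (g1 t).
  move=> _; rewrite /g /g1.
  apply: is_derive_eq; rewrite !scaler0 /GRing.scale/= /GRing.scale/=.
  by field.
have iT : is_interval [set: R] by [].
have [c [_ cxy]] := MVT_interval iT gg1 (I : setT x) (I : setT y).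
have -> : w = y - x by rewrite /y; ring.
have -> : g y - g x = f y - f x - (y - x) * f1 x - (y - x) ^+ 2 / 2 * f2 x.
  by rewrite /g; ring.
move=> ->; rewrite normrM exprSr mulrA ler_wpM2r//.
have := @taylor1 setT f1 f2 f3 M x c iT (fun t _ => f12 t)
  (fun t _ => f23 t) (fun t _ => f3M t) I I.
move=> /le_trans; apply; rewrite -(real_normK (num_real (c - x))).
by rewrite ler_wpM2l ?(le_trans _ (f3M x))// lerXn2r ?nnegrE.
Qed.

End taylor.

(** * The normal distribution function and the heat equation *)

Section normal_cdf.
Context {R : realType}.
Implicit Types s h x w z : R.

(** Here [s] is a standard deviation, as in [normal_prob]; in [heat1], [heat2] and the Taylor
    estimates it is a variance. *)
Definition ncdf s x : R := fine (normal_prob 0 s `]-oo, x]).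

Local Notation phi := (@normal_pdf R 0 1).
Local Notation Phi := (ncdf 1).

Lemma ncdf_fin s x : normal_prob 0 s `]-oo, x] = (ncdf s x)%:E.
Proof. by rewrite fineK// fin_num_measure. Qed.

Lemma ncdf_ge0 s x : 0 <= ncdf s x.
Proof. by rewrite fine_ge0. Qed.

Lemma ncdf_le1 s x : ncdf s x <= 1.
Proof. by rewrite -lee_fin -ncdf_fin probability_le1. Qed.

Lemma ncdf_homo s : {homo ncdf s : x y / x <= y}.
Proof.
move=> x y xy; rewrite -lee_fin -!ncdf_fin le_measure ?inE//.
by apply: subset_itvl; rewrite bnd_simp.
Qed.

(** The identity is a random variable whose [cdf] under a normal law is the distribution function of
    that law, so the limits known for [cdf] apply. *)
Let idTR : measurableTypeR R -> R := idfun.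

#[local] HB.instance Definition _ :=
  @isMeasurableFun.Build _ _ _ _ idTR (@measurable_id _ _ setT).

Lemma ncdf_cvgNy s : ncdf s x @[x --> -oo] --> 0.
Proof.
apply: fine_cvg.
have := cvg_cdfNy0 (idTR : {RV (normal_prob 0 s) >-> R}).
exact.
Qed.

Lemma ncdf_cvgy s : ncdf s x @[x --> +oo] --> (1 : R).
Proof.
by apply: fine_cvg; exact: (cvg_cdfy1 (idTR : {RV (normal_prob 0 s) >-> R})).
Qed.

Lemma is_derive_ncdf s x : s != 0 -> is_derive x 1 (ncdf s) (normal_pdf 0 s x).
Proof.
move=> s0.
have [||||d dE] := @continuous_FTC1 R (normal_pdf 0 s) -oo%O x (x + 1).
- by rewrite ltrDl.
- apply: integrableS (integrable_normal_pdf 0 s) => //.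

- by rewrite ltNyr.
- exact: continuous_normal_pdf.
by rewrite -dE derive1E; exact: derivableP.
Qed.

Lemma normal_pdf0E s z : 0 < s ->
  normal_pdf 0 s z = normal_peak 1 / s * expR (- ((z / s) ^+ 2 / 2)).
Proof.
move=> s0; rewrite normal_pdfE ?gt_eqF// /normal_fun subr0; congr (_ * expR _).
  rewrite /normal_peak expr1n mul1r -mulrnAr sqrtrM ?sqr_ge0//.
  by rewrite sqrtr_sqr gtr0_norm// invfM mulrC.
by rewrite mulNr expr_div_n -mulr_natr invfM mulrA.
Qed.

Lemma normal_pdf01E z : phi z = normal_peak 1 * expR (- (z ^+ 2 / 2)).
Proof. by rewrite normal_pdf0E// !divr1. Qed.

Lemma is_derive_normal_pdf z : is_derive z 1 phi (- z * phi z).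
Proof.
rewrite normal_pdf01E (funext normal_pdf01E).
apply: is_derive_eq; rewrite /GRing.scale/=; by field.
Qed.

(** A single weight of degree 4 covers every derivative needed below, the worst being a cubic times
    [phi]. *)
Lemma normal_pdf_decay :
  exists2 C : R, 0 <= C & forall z, (1 + z ^+ 2) ^+ 2 * phi z <= C.
Proof.
(* [expR (z ^+ 2 / 2)] is the square of [expR (z ^+ 2 / 4)], which is at least [1 + z ^+ 2 / 4];
   hence it is at least [(1 + z ^+ 2) ^+ 2 / 16]. *)
exists (16 * normal_peak 1) => [|z]; first by rewrite mulr_ge0// normal_peak_ge0.
rewrite normal_pdf01E mulrCA [16 * _]mulrC ler_wpM2l ?normal_peak_ge0//.
rewrite expRN ler_pdivrMr ?expR_gt0//.
have -> : z ^+ 2 / 2 = z ^+ 2 / 4 + z ^+ 2 / 4 by field.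
rewrite expRD; have := expR_ge1Dx (z ^+ 2 / 4).
have : 0 <= z ^+ 2 by rewrite sqr_ge0.
move: (expR _) => e; move: (z ^+ 2) => q q0 qe; nra.
Qed.

(** Both sides have the same derivative in [x] and the same limit 0 at -oo. *)
Lemma ncdf_scale s x : 0 < s -> ncdf s x = Phi (x / s).
Proof.
move=> s0; have sn0 : s != 0 by rewrite gt_eqF.
pose D y := ncdf s y - Phi (y / s).
have dD (y : R) : is_derive y 1 D 0.
  have ? := is_derive_ncdf y sn0.
  have ? := is_derive_ncdf (y / s) (oner_neq0 R).
  apply: is_derive_eq; rewrite normal_pdf0E// normal_pdf01E /GRing.scale/=.
  by field.
suff : D x = 0 by move/eqP; rewrite subr_eq0 => /eqP.
have : D y @[y --> -oo] --> 0.
  rewrite -(subr0 0); apply: cvgB; first exact: ncdf_cvgNy.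
  apply: (cvg_comp _ _ _ (ncdf_cvgNy 1)).
  by apply: gt0_cvgMlNy => //; rewrite invr_gt0.
have -> : D = cst (D x) by apply/funext => y; exact: is_derive_0_is_cst.
by move/cvg_lim => <- //; rewrite lim_cst.
Qed.

(* With z = x / sqrt s, these are the first two derivatives in y of
   Phi ((x - y) / sqrt s) at y = 0. *)
Definition heat1 s x : R := - phi (x / Num.sqrt s) / Num.sqrt s.
Definition heat2 s x : R := - (x / Num.sqrt s * phi (x / Num.sqrt s)) / s.

Lemma measurable_ncdf s : measurable_fun setT (ncdf s).
Proof. by apply: nondecreasing_measurable => // x y; exact: ncdf_homo. Qed.

Lemma measurable_heat1 s : measurable_fun setT (heat1 s).
Proof.
apply: measurable_funM => //; apply: measurableT_comp => //.
apply: (measurableT_comp (measurable_normal_pdf _ _)).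
exact: measurable_funM.
Qed.

Lemma measurable_heat2 s : measurable_fun setT (heat2 s).
Proof.
apply: measurable_funM => //; apply: measurableT_comp => //.
apply: measurable_funM; first exact: measurable_funM.
apply: (measurableT_comp (measurable_normal_pdf _ _)).
exact: measurable_funM.
Qed.

Lemma heat1_bounded s : 0 < s -> exists M : R, forall x, `|heat1 s x| <= M.
Proof.
move=> s0; exists (normal_peak 1 / Num.sqrt s) => x.
rewrite normrM normrN !ger0_norm ?normal_pdf_ge0 ?invr_ge0 ?sqrtr_ge0//.
by rewrite ler_wpM2r ?invr_ge0 ?sqrtr_ge0// normal_pdf_ub// oner_neq0.
Qed.

Lemma heat2_bounded s : 0 < s -> exists M : R, forall x, `|heat2 s x| <= M.
Proof.
move=> s0; have [C _ HC] := normal_pdf_decay; exists (C / s) => x.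
have sV0 : 0 <= s^-1 by rewrite invr_ge0 ltW.
rewrite normrM normrN (ger0_norm sV0) ler_wpM2r//.
apply: le_trans (HC (x / Num.sqrt s)); rewrite normrM.
rewrite (ger0_norm (normal_pdf_ge0 _ _ _)) ler_wpM2r ?normal_pdf_ge0//.
by move: (x / _) => z; rewrite ler_norml; apply/andP; split; nra.
Qed.

(** Taylor's formula for [Phi] at [x / Num.sqrt s] with increment [- w / Num.sqrt s]. The third
    derivative [(z ^+ 2 - 1) * phi z] is bounded, so the constant is uniform in [x], which will be
    random, and in [s]. *)
Lemma ncdf_taylor_space : exists2 C : R, 0 <= C & forall s x w, 0 < s ->
  `|Phi ((x - w) / Num.sqrt s) - Phi (x / Num.sqrt s) - w * heat1 s x -
    w ^+ 2 / 2 * heat2 s x| <= C * `|w| ^+ 3 / (Num.sqrt s) ^+ 3.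
Proof.
have [C C0 HC] := normal_pdf_decay; exists C => // s x w s0.
have d1 (t : R) := is_derive_ncdf t (oner_neq0 R).
have d2 := is_derive_normal_pdf.
have d3 (t : R) : is_derive t 1 (fun t => - t * phi t) ((t ^+ 2 - 1) * phi t).
  by apply: is_derive_eq; rewrite /GRing.scale/=; ring.
have := @taylor2 R Phi phi (fun t => - t * phi t) _ C (x / Num.sqrt s)
  (- w / Num.sqrt s) d1 d2 d3.
have r0 : 0 < Num.sqrt s by rewrite sqrtr_gt0.
rewrite normrM normrN (gtr0_norm (_ : 0 < (Num.sqrt s)^-1)) ?invr_gt0//.
rewrite -mulrDl !expr_div_n -(mulrA C) => H.
rewrite (le_trans _ (H _)) => {H}// [|t]; last first.
  rewrite normrM (ger0_norm (normal_pdf_ge0 _ _ _)).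
  apply: le_trans (HC t); rewrite ler_wpM2r ?normal_pdf_ge0//.
  by rewrite ler_norml; apply/andP; split; nra.
rewrite /heat1 /heat2 -[in X in _ / 2 * (- (_) / X)](sqr_sqrtr (ltW s0)).
rewrite le_eqVlt; apply/orP; left; apply/eqP; congr `|_|.
by field; rewrite gt_eqF.
Qed.

(** This is where the heat equation enters: [f1], the derivative of [Phi (x / Num.sqrt t)] in [t],
    is half of [heat2 t x]. The second derivative [f2] is O(t^(-2)) uniformly in [x], hence bounded
    by [C / s ^+ 2] for [t >= s]. *)
Lemma ncdf_taylor_time : exists2 C : R, 0 <= C &
  forall s h x, 0 < s -> 0 <= h ->
  `|Phi (x / Num.sqrt (s + h)) - Phi (x / Num.sqrt s) - h / 2 * heat2 s x|
    <= C * h ^+ 2 / s ^+ 2.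
Proof.
have [C C0 HC] := normal_pdf_decay; exists C => // s h x s0 h0.
pose z t := x / Num.sqrt t.
have dz (t : R) : s <= t -> is_derive t 1 z (- z t / (2 * t)).
  move=> st; have t0 := lt_le_trans s0 st.
  have r0 : Num.sqrt t != 0 by rewrite gt_eqF// sqrtr_gt0.
  have ? := is_deriveV r0 (is_derive1_sqrt t0).
  apply: is_derive_eq; rewrite /z /GRing.scale/= /GRing.scale/=.
  rewrite -[in RHS](sqr_sqrtr (ltW t0)) sqrtr_sqr ger0_norm ?sqrtr_ge0//.
  by field.
pose f t := Phi (z t).
pose f1 t := 2^-1 * (- (z t * phi (z t)) / t).
pose f2 t := (3 * z t - z t ^+ 3) * phi (z t) / (4 * t ^+ 2).
have df t : s <= t -> is_derive t 1 f (f1 t).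
  move=> st; have t0 := lt_le_trans s0 st.
  have ? := dz t st; have ? := is_derive_ncdf (z t) (oner_neq0 R).
  by apply: is_derive_eq; rewrite /f1; field; rewrite gt_eqF.
have df1 t : s <= t -> is_derive t 1 f1 (f2 t).
  move=> st; have t0 := lt_le_trans s0 st.
  have ? := dz t st; have ? := is_derive_normal_pdf (z t).
  have tn0 : t != 0 by rewrite gt_eqF.
  have ? := is_deriveV tn0 (is_derive_id t (1 : R)).
  by apply: is_derive_eq; rewrite /f2 /GRing.scale/= /GRing.scale/=; field.
have bf2 t : s <= t -> `|f2 t| <= C / s ^+ 2.
  move=> st; have t0 := lt_le_trans s0 st.
  rewrite /f2 normrM ler_pM//.
    rewrite normrM (ger0_norm (normal_pdf_ge0 _ _ _)).
    apply: le_trans (HC (z t)); rewrite ler_wpM2r ?normal_pdf_ge0//.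
    have main (y : R) : 3 * y - y ^+ 3 <= (1 + y ^+ 2) ^+ 2.
      (* [(1 + y ^+ 2) ^+ 2 - 3 * y + y ^+ 3] is the first square plus 9/4 of the second plus
         7/72. *)
      have := sqr_ge0 (y ^+ 2 + y / 2 - 1 / 4).
      by have := sqr_ge0 (y - 11 / 18); nra.
    have := main (z t); have := main (- z t).
    by move: (z t) => y H1 H2; rewrite ler_norml; apply/andP; split; nra.
  have t20 : 0 < 4 * t ^+ 2 by rewrite mulr_gt0// exprn_gt0.
  rewrite gtr0_norm ?invr_gt0// lef_pV2 ?posrE ?exprn_gt0//; nra.
have iD : is_interval [set t | s <= t].
  by move=> a b /= sa _ t /andP[/(le_trans sa)].
have := taylor1 iD df df1 bf2.
move=> /(_ s (s + h)); rewrite /= lexx lerDl h0 => /(_ isT isT).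
rewrite /f /f1 /z (_ : s + h - s = h); last by ring.
by rewrite (mulrA h) [C / _ * _]mulrAC.
Qed.

End normal_cdf.

(** * Means and independence *)

Section mean.
Context d (T : measurableType d) (R : realType) (P : probability T R).
Implicit Types (Y Z : T -> R) (u v c : R).

(** Integrability is recorded along with the value because the real-valued integral is a total
    operation, whose value alone does not imply it. *)
Definition has_mean Y v :=
  P.-integrable setT (EFin \o Y) /\ \int[P]_w Y w = v.

Lemma has_mean_measurable Y v : has_mean Y v -> measurable_fun setT Y.
Proof. by move=> [/measurable_int/measurable_EFinP]. Qed.

Lemma has_mean_integral Y v : has_mean Y v -> \int[P]_w Y w = v.
Proof. by case. Qed.

Lemma has_meanE Y v : has_mean Y v -> (\int[P]_w (Y w)%:E = v%:E)%E.
Proof.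
move=> [iY <-]; rewrite /Rintegral fineK//.
exact: integrable_fin_num.
Qed.

Lemma eq_has_mean Y Z v : Y =1 Z -> has_mean Y v -> has_mean Z v.
Proof. by move=> /funext ->. Qed.

Lemma has_mean_congr Y Z u v : Y =1 Z -> u = v -> has_mean Y u -> has_mean Z v.
Proof. by move=> /funext -> ->. Qed.

Lemma has_mean_cst c : has_mean (fun=> c) c.
Proof.
split; first exact: finite_measure_integrable_cst.
by rewrite Rintegral_cst//= probability_setT mulr1.
Qed.

Lemma has_meanD Y Z u v : has_mean Y u -> has_mean Z v ->
  has_mean (fun w => Y w + Z w) (u + v).
Proof.
move=> [iY <-] [iZ <-]; split; last by rewrite RintegralD.
by apply: eq_integrable (integrableD _ iY iZ).
Qed.

Lemma has_meanZ Y c v : has_mean Y v -> has_mean (fun w => c * Y w) (c * v).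
Proof.
move=> [iY <-]; split; last by rewrite RintegralZl.
by apply: eq_integrable (integrableZl _ c iY).
Qed.

Lemma has_meanN Y v : has_mean Y v -> has_mean (fun w => - Y w) (- v).
Proof.
move=> /(has_meanZ (-1)); rewrite mulN1r; apply: eq_has_mean => w.
by rewrite mulN1r.
Qed.

Lemma has_meanB Y Z u v : has_mean Y u -> has_mean Z v ->
  has_mean (fun w => Y w - Z w) (u - v).
Proof. by move=> mY /has_meanN; exact: has_meanD. Qed.

Lemma has_mean_le Y Z u v : has_mean Y u -> has_mean Z v ->
  (forall w, Y w <= Z w) -> u <= v.
Proof. by move=> [iY <-] [iZ <-] YZ; exact: le_Rintegral. Qed.

Lemma has_mean_norm_le Y Z u v : has_mean Y u -> has_mean Z v ->
  (forall w, `|Y w| <= Z w) -> `|u| <= v.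
Proof.
move=> mY mZ YZ; rewrite ler_norml; apply/andP; split.
  apply: has_mean_le (has_meanN mZ) mY _ => w.
  by have := YZ w; rewrite ler_norml => /andP[].
by apply: has_mean_le mY mZ _ => w; rewrite (le_trans (ler_norm _)).
Qed.

Lemma dominated_has_mean Y Z v : measurable_fun setT Y -> has_mean Z v ->
  (forall w, `|Y w| <= Z w) -> has_mean Y (\int[P]_w Y w).
Proof.
move=> mY [iZ _] YZ; split => //.
apply: le_integrable iZ => //; first exact/measurable_EFinP.
by move=> w _ /=; rewrite lee_fin (le_trans (YZ w))// ler_norm.
Qed.

Lemma bounded_has_mean Y c : measurable_fun setT Y ->
  (forall w, `|Y w| <= c) -> has_mean Y (\int[P]_w Y w).
Proof. by move=> mY; exact: dominated_has_mean (has_mean_cst c). Qed.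

Lemma has_mean_indic (A : set T) : measurable A -> has_mean (\1_A) (fine (P A)).
Proof.
move=> mA; split; last by rewrite /Rintegral integral_indic// setIT.
by apply: integrable_indic => //; rewrite (le_lt_trans (probability_le1 _ _)) ?ltry.
Qed.

Lemma has_mean_sum n (Y : 'I_n -> T -> R) (v : 'I_n -> R) :
  (forall i, has_mean (Y i) (v i)) ->
  has_mean (fun w => \sum_(i < n) Y i w) (\sum_(i < n) v i).
Proof.
elim: n Y v => [|n IH] Y v H.
  rewrite big_ord0; apply: eq_has_mean (has_mean_cst 0) => w.
  by rewrite big_ord0.
rewrite big_ord_recr/=.
apply: eq_has_mean (has_meanD (IH _ _ (fun i => H (widen_ord (leqnSn n) i)))
  (H ord_max)) => w.
by rewrite big_ord_recr.
Qed.

Lemma has_mean_chebyshev Y v c : measurable_fun setT Y ->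
  has_mean (fun w => Y w ^+ 2) v -> 0 < c ->
  fine (P [set w | c <= `|Y w|]) <= v / c ^+ 2.
Proof.
move=> mY hY c0.
have mA : measurable [set w | c <= `|Y w|].
  rewrite -[X in measurable X]setTI.
  by apply: measurable_fun_le => //; exact: measurableT_comp.
rewrite mulrC; apply: has_mean_le (has_mean_indic mA) (has_meanZ _ hY) _ => w.
rewrite indicE; have [/set_mem/= cY|_] := boolP (w \in _); last first.
  by rewrite mulr_ge0 ?invr_ge0 ?sqr_ge0.
rewrite mulrC ler_pdivlMr ?exprn_gt0// mul1r -(real_normK (num_real (Y w))).
by rewrite lerXn2r ?nnegrE// ltW.
Qed.

End mean.

(** * Independence of two variables and the mean of a product *)

Section independence.
Context d (T : measurableType d) (R : realType) (P : probability T R).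
Implicit Types (U V : T -> R) (u v : R).

Definition independent2 U V := forall A B : set R, measurable A -> measurable B ->
  P (U @^-1` A `&` V @^-1` B) = (P (U @^-1` A) * P (V @^-1` B))%E.

Lemma independent2_comp (f g : R -> R) U V :
  measurable_fun setT f -> measurable_fun setT g ->
  independent2 U V -> independent2 (f \o U) (g \o V).
Proof.
move=> mf mg UV A B mA mB; apply: (UV (f @^-1` A) (g @^-1` B)).
  by rewrite -[X in measurable X]setTI; exact: mf.
by rewrite -[X in measurable X]setTI; exact: mg.
Qed.

Section has_meanM.
Variables U V : {mfun T >-> R}.
Hypothesis UV : independent2 U V.
Local Open Scope ereal_scope.

Let W : T -> R * R := fun w => (U w, V w).

Let mW : measurable_fun [set: T] W.
Proof. exact: measurable_fun_pair. Qed.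

#[local] HB.instance Definition _ :=
  @isMeasurableFun.Build _ _ _ _ W mW.

Let law := distribution P (W : {mfun T >-> (R * R)%type}).
Let lawU := distribution P U.
Let lawV := distribution P V.

(** Independence makes the joint law and the product of the laws agree on rectangles; uniqueness of
    the product measure extends this to all measurable sets and gives access to Fubini's theorem. *)
Let lawE A : measurable A -> (lawU \x lawV) A = law A.
Proof. by apply: product_measure_unique => B C mB mC; exact: UV. Qed.

Let f (z : R * R) : \bar R := (z.1 * z.2)%:E.

Let mf : measurable_fun [set: R * R] f.
Proof.
apply/measurable_EFinP; apply: measurable_funM; first exact: measurable_fst.
exact: measurable_snd.
Qed.

(** By Tonelli's theorem the integral of the absolute value factorizes into two finite ones. *)
Let UV_integrable : P.-integrable setT (EFin \o U) ->
  P.-integrable setT (EFin \o V) -> P.-integrable setT (f \o W).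
Proof.
move=> /integrableP[_ iU] /integrableP[_ iV]; apply/integrableP; split.
  exact: measurableT_comp.
have mab : measurable_fun setT (fun z => `|f z|) by exact: measurableT_comp.
have mn : measurable_fun [set: R] (fun y : R => `|y|%:E).
  by apply/measurable_EFinP; exact: normr_measurable.
rewrite -(@ge0_integral_distribution _ _ _ _ _ P W (fun z => `|f z|))//.
rewrite (eq_measure_integral (lawU \x lawV)); last first.
  by move=> A mA _; apply/esym; exact: lawE.
rewrite fubini_tonelli1//.
rewrite /fubini_F; under eq_integral => x _.
  under eq_integral => y _ do rewrite /f/= normrM EFinM.
  rewrite ge0_integralZl//.
  over.
rewrite ge0_integralZr//; last exact: integral_ge0.
rewrite (@ge0_integral_distribution _ _ _ _ _ P U (fun z => `|z|%:E))//.
rewrite (@ge0_integral_distribution _ _ _ _ _ P V (fun z => `|z|%:E))//.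
have I0 : 0 <= \int[P]_x `|(EFin \o U) x|.
  by apply: integral_ge0 => x _; exact: abse_ge0.
apply: lte_mul_pinfty; [exact: I0| |exact: iV].
by rewrite ge0_fin_numE; [exact: iU|exact: I0].
Qed.

Lemma independent2_integralM u v : has_mean P U u -> has_mean P V v ->
  has_mean P (fun w => U w * V w)%R (u * v)%R.
Proof.
move=> mU mV; have iUV := UV_integrable mU.1 mV.1; split => //.
have iU : lawU.-integrable setT EFin.
  by apply: integrable_pushforward => //; exact: mU.1.
have iV : lawV.-integrable setT EFin.
  by apply: integrable_pushforward => //; exact: mV.1.
have ilaw : (lawU \x lawV).-integrable setT f.
  apply/integrableP; split => //; rewrite (eq_measure_integral law); last first.
    by move=> A mA _; exact: lawE.
  rewrite (@ge0_integral_distribution _ _ _ _ _ P W (fun z => `|f z|))//.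
    by have /integrableP[] := iUV.
  exact: measurableT_comp.
rewrite /Rintegral -[LHS]/(fine (\int[P]_w (f \o W) w)).
rewrite -(@integral_distribution _ _ _ _ _ P W f)//.
rewrite (eq_measure_integral (lawU \x lawV)); last first.
  by move=> A mA _; apply/esym; exact: lawE.
rewrite -integral12_prod_meas1// /fubini_F.
under eq_integral => x _.
  rewrite /f/=.
  under eq_integral => y _ do rewrite EFinM.
  rewrite integralZl//.
  rewrite (@integral_distribution _ _ _ _ _ P V EFin)//; last exact: mV.1.
  rewrite (has_meanE mV).
  over.
rewrite integralZr//.
rewrite (@integral_distribution _ _ _ _ _ P U EFin)//; last exact: mU.1.
by rewrite (has_meanE mU).
Qed.

End has_meanM.

Lemma independent2_has_meanM U V u v : independent2 U V ->
  has_mean P U u -> has_mean P V v -> has_mean P (fun w => U w * V w) (u * v).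
Proof.
move=> UV mU mV.
pose U' : {mfun T >-> R} := mfun_Sub (mem_set (has_mean_measurable mU)).
pose V' : {mfun T >-> R} := mfun_Sub (mem_set (has_mean_measurable mV)).
exact: (@independent2_integralM U' V').
Qed.

End independence.

(** * Partial sums of independent variables *)

Section sums.
Context d (T : measurableType d) (R : realType) (P : probability T R).
Variable X : nat -> {RV P >-> R}.
Hypothesis X_indep : mutually_independent P X.

Lemma independent_bigcap n (A : nat -> set R) :
  (forall i, measurable (A i)) ->
  P (\bigcap_(i in `I_n) X i @^-1` A i) = (\prod_(i < n) P (X i @^-1` A i))%E.
Proof.
move=> mA; have := X_indep (seq_fset tt (iota 0 n)) mA.
have -> : [set` seq_fset tt (iota 0 n)] = `I_n.
  by apply/seteqP; split => i; rewrite /= (seq_fsetE tt) mem_iota add0n.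
move=> ->; rewrite -(big_mkord xpredT (fun i => P (X i @^-1` A i))).
rewrite /index_iota subn0; apply: perm_big.
by rewrite (perm_trans (seq_fset_perm _ _))// undup_id ?iota_uniq.
Qed.

Section past.
Variable n : nat.

(** These cylinder sets form a pi-system generating the sigma-algebra of the first [n] variables. *)
Let G : set (set T) := [set B | exists2 A : nat -> set R,
  forall i, measurable (A i) & B = \bigcap_(i in `I_n) X i @^-1` A i].

Let mXi i (A : set R) : measurable A -> measurable (X i @^-1` A).
Proof. by move=> mA; rewrite -[X in measurable X]setTI; exact: measurable_funP. Qed.

Let G_measurable : G `<=` measurable.
Proof.
move=> _ [A mA ->]; apply: fin_bigcap_measurable => // i _; exact: mXi.
Qed.

Let G_setI : setI_closed G.
Proof.
move=> _ _ [A mA ->] [B mB ->]; exists (fun i => A i `&` B i) => [i|].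
  exact: measurableI.
by rewrite -bigcapI.
Qed.

Let G_setT : G setT.
Proof. by exists (fun=> setT) => //; rewrite bigcapT. Qed.

(** Restricting [P] to the event that [X n] lies in [A], and scaling [P] by the probability of that
    event, give two finite measures; they agree on the pi-system [G], hence on the sigma-algebra it
    generates. *)
Let past_independent (B : set T) (A : set R) : <<s G >> B -> measurable A ->
  P (B `&` X n @^-1` A) = (P B * P (X n @^-1` A))%E.
Proof.
move=> sGB mA; have mE := mXi n mA; rewrite muleC.
have p0 : 0 <= fine (P (X n @^-1` A)) by rewrite fine_ge0.
pose m2 := mscale (NngNum p0) P.
suff -> : P (B `&` X n @^-1` A) = m2 B.
  by rewrite /m2 /mscale/= fineK// fin_num_measure.
rewrite -[LHS]/(mrestr P mE B).
apply: (@g_sigma_algebra_measure_unique _ _ _ G _ (fun=> setT)) => //.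
- by rewrite -subTset => w _; exists 0%N.
- move=> _ [C mC ->]; rewrite -[RHS]/((fine (P (X n @^-1` A)))%:E * P _)%E.
  rewrite fineK ?fin_num_measure// -[LHS]/(P (_ `&` _)).
  rewrite [in RHS]independent_bigcap// muleC.
  (* Placing [A] at index [n] turns the intersection into a cylinder of length [n.+1]. *)
  pose C' i := if i == n then A else C i.
  have mC' i : measurable (C' i) by rewrite /C'; case: ifP.
  rewrite (_ : _ `&` _ = \bigcap_(i in `I_n.+1) X i @^-1` C' i).
    rewrite independent_bigcap// big_ord_recr/= /C' eqxx; congr (_ * _)%E.
    by apply: eq_bigr => i _; rewrite ltn_eqF.
  rewrite (_ : `I_n.+1 = `I_n `|` [set n]).
    rewrite bigcap_setU bigcap_set1 /C' eqxx; congr (_ `&` _).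
    by apply: eq_bigcapr => i /= /ltn_eqF ->.
  by rewrite IIS.
- by move=> k; rewrite /mrestr (le_lt_trans (probability_le1 _ _)) ?ltry// setTI.
Qed.

Lemma independent2_sum (f : R -> R) : measurable_fun setT f ->
  independent2 P (fun w => \sum_(i < n) f (X i w)) (X n).
Proof.
move=> mf A B mA mB; apply: past_independent => //.
have mX (i : 'I_n) :
    measurable_fun [set: g_sigma_algebraType G] (fun w => f (X i w)).
  apply: (measurableT_comp mf) => _ /= C mC.
  rewrite setTI; apply: sub_sigma_algebra.
  exists (fun j => if j == i :> nat then C : set R else setT) => [j|].
    by case: ifP.
  apply/seteqP; split => w /=.
    by move=> Cw j _; case: ifPn => [/eqP ->|].
  by move=> /(_ i (ltn_ord i)); rewrite eqxx.
have : measurable_fun [set: g_sigma_algebraType G]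
    (fun w => \sum_(i < n) f (X i w)).
  exact: measurable_sum.
by move=> /(_ measurableT A mA); rewrite setTI.
Qed.

End past.

(** By induction on [n]: the cross term has mean 0, since the partial sum is independent of the next
    summand and both are centred. *)
Lemma has_mean_sqr_sum (f : R -> R) v n : measurable_fun setT f ->
  (forall i, has_mean P (fun w => f (X i w)) 0) ->
  (forall i, has_mean P (fun w => f (X i w) ^+ 2) v) ->
  has_mean P (fun w => (\sum_(i < n) f (X i w)) ^+ 2) (n%:R * v).
Proof.
move=> mf mean0 meanv; elim: n => [|n IH].
  rewrite mul0r; apply: eq_has_mean (has_mean_cst P 0) => w.
  by rewrite big_ord0 expr0n.
have mS : has_mean P (fun w => \sum_(i < n) f (X i w)) 0.
  by have := has_mean_sum (fun i : 'I_n => mean0 i); rewrite big1.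
have ind := independent2_comp (@measurable_id _ R setT) mf (independent2_sum n mf).
have := has_meanD (has_meanD IH (has_meanZ 2 (independent2_has_meanM ind mS (mean0 n))))
  (meanv n).
rewrite (_ : _ + _ + v = n.+1%:R * v); last by rewrite -[n.+1%:R]natr1; ring.
apply: eq_has_mean => w /=.
by rewrite big_ord_recr/=; ring.
Qed.

End sums.

(** * Lindeberg replacement *)

Lemma near_sqrt_ge (R : realType) (K : R) :
  \forall n \near \oo, K <= Num.sqrt (n%:R : R).
Proof.
near=> n; rewrite (le_trans (ler_norm K))// -sqrtr_sqr ler_sqrt//.
by near: n; exact: nbhs_infty_ger.
Unshelve. all: by end_near. Qed.

Section lindeberg.
Context d (T : measurableType d) (R : realType) (P : probability T R).
Local Notation Phi := (@ncdf R 1).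

Lemma has_mean_ncdf (U : T -> R) : measurable_fun setT U ->
  has_mean P (fun w => Phi (U w)) (\int[P]_w Phi (U w)).
Proof.
move=> mU; apply: (@bounded_has_mean _ _ _ _ _ 1) => [|w].
  exact: (measurableT_comp (measurable_ncdf 1)).
by rewrite ger0_norm ?ncdf_ge0 ?ncdf_le1.
Qed.

(* Adding the independent increment V changes the mean of a function smoothed
   by a Gaussian of variance s as much as increasing s by the variance of V,
   because both Taylor expansions share the term heat2. *)
Lemma lindeberg_step : exists C1 C2 : R, [/\ 0 <= C1, 0 <= C2 &
  forall (U V : T -> R) (v b s a : R), independent2 P U V ->
    measurable_fun setT U -> has_mean P V 0 ->
    has_mean P (fun w => V w ^+ 2) v -> has_mean P (fun w => `|V w| ^+ 3) b ->
    0 < s ->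
  `|\int[P]_w Phi ((a - (U w + V w)) / Num.sqrt s) -
    \int[P]_w Phi ((a - U w) / Num.sqrt (s + v))| <=
  C1 * b / Num.sqrt s ^+ 3 + C2 * v ^+ 2 / s ^+ 2].
Proof.
have [C1 C10 H1] := @ncdf_taylor_space R.
have [C2 C20 H2] := @ncdf_taylor_time R.
exists C1, C2; split => // U V v b s a UV mU V0 V2 V3 s0.
have mV := has_mean_measurable V0.
have v0 : 0 <= v.
  by apply: has_mean_le (has_mean_cst P 0) V2 _ => w; rewrite sqr_ge0.
have maU : measurable_fun setT (fun w => a - U w) by exact: measurable_funB.
have mh1 := measurableT_comp (measurable_heat1 s) maU.
have mh2 := measurableT_comp (measurable_heat2 s) maU.
have [M1 b1] := heat1_bounded s0; have [M2 b2] := heat2_bounded s0.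
have E1 := bounded_has_mean P mh1 (fun w => b1 (a - U w)).
have E2 := bounded_has_mean P mh2 (fun w => b2 (a - U w)).
have mB : measurable_fun setT (fun x : R => a - x) by exact: measurable_funB.
have ind1 : independent2 P (heat1 s \o (fun w => a - U w)) V.
  apply: (independent2_comp (f := heat1 s \o (fun x => a - x)) (g := id)) UV => //.
  exact: measurableT_comp (measurable_heat1 s) mB.
(* The second-order term of the expansion in space and the first-order term of the expansion in time
   combine into [heat2] times [(V ^+ 2 - v) / 2], whose mean vanishes by independence. *)
have ind2 : independent2 P (heat2 s \o (fun w => a - U w)) (fun w => V w ^+ 2 - v).
  apply: (independent2_comp (f := heat2 s \o (fun x => a - x))
    (g := fun x => x ^+ 2 - v)) UV.
    exact: measurableT_comp (measurable_heat2 s) mB.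
  by apply: measurable_funB => //; exact: measurable_funX.
have V2v := has_meanB V2 (has_mean_cst P v); rewrite subrr in V2v.
have M1' := independent2_has_meanM ind1 E1 V0.
have M2' := has_meanZ 2^-1 (independent2_has_meanM ind2 E2 V2v).
have mL : measurable_fun setT (fun w => (a - (U w + V w)) / Num.sqrt s).
  apply: measurable_funM => //; apply: measurable_funB => //.
  exact: measurable_funD.
have L := has_mean_ncdf mL.
have mL' : measurable_fun setT (fun w => (a - U w) / Num.sqrt (s + v)).
  exact: measurable_funM.
have L' := has_mean_ncdf mL'.
(* The last two terms subtracted have mean 0, so this combination has the mean to be bounded;
   pointwise it is the difference of the two Taylor remainders. *)
have := has_meanB (has_meanB (has_meanB L L') M1') M2'.
have maj := has_meanD (has_meanZ (C1 / Num.sqrt s ^+ 3) V3)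
  (has_mean_cst P (C2 * v ^+ 2 / s ^+ 2)).
move=> /has_mean_norm_le => /(_ _ _ maj).
rewrite !mulr0 !subr0 [_ * b]mulrAC => H; apply: H => w /=.
set x := a - U w.
have -> : a - (U w + V w) = x - V w by rewrite /x; ring.
rewrite [C1 / _ * _]mulrAC; apply: le_trans (lerD (H1 s x (V w) s0) (H2 s v x s0 v0)).
apply: le_trans (ler_normB _ _).
rewrite le_eqVlt; apply/orP; left; apply/eqP; congr `|_|.
by field.
Qed.

Variables (X : nat -> {RV P >-> R}) (f : R -> R) (v b : R).
Hypothesis X_indep : mutually_independent P X.
Hypothesis mf : measurable_fun setT f.
Hypothesis mean0 : forall i, has_mean P (fun w => f (X i w)) 0.
Hypothesis mean2 : forall i, has_mean P (fun w => f (X i w) ^+ 2) v.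
Hypothesis mean3 : forall i, has_mean P (fun w => `|f (X i w)| ^+ 3) b.

Local Notation S n w := (\sum_(i < n) f (X i w)).

Lemma measurable_partial_sum n : measurable_fun setT (fun w => S n w).
Proof. by apply: measurable_sum => i; exact: measurableT_comp. Qed.

Lemma second_moment_ge0 : 0 <= v.
Proof.
by apply: has_mean_le (has_mean_cst P 0) (mean2 0) _ => w; rewrite sqr_ge0.
Qed.

Lemma abs_moment_ge0 : 0 <= b.
Proof.
by apply: has_mean_le (has_mean_cst P 0) (mean3 0) _ => w; rewrite exprn_ge0.
Qed.

(** By induction on [n] with [s] universally quantified: the last summand is traded for the variance
    [v], and the other ones are replaced at level [s + v], where the error per summand is no larger
    because it decreases in [s]. *)
Lemma lindeberg : exists C1 C2 : R, [/\ 0 <= C1, 0 <= C2 &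
  forall n s a, 0 < s ->
  `|\int[P]_w Phi ((a - S n w) / Num.sqrt s) - Phi (a / Num.sqrt (s + n%:R * v))|
  <= n%:R * (C1 * b / Num.sqrt s ^+ 3 + C2 * v ^+ 2 / s ^+ 2)].
Proof.
have [C1 [C2 [C10 C20 step]]] := lindeberg_step.
have v0 := second_moment_ge0; have b0 := abs_moment_ge0.
exists C1, C2; split => //; elim=> [|n IH] s a s0.
  rewrite !mul0r addr0 (_ : \int[P]_w _ = Phi (a / Num.sqrt s)) ?subrr ?normr0//.
  under eq_Rintegral do rewrite big_ord0 subr0.
  exact: has_mean_integral (has_mean_cst P _).
have ind := independent2_comp (@measurable_id _ R setT) mf
  (independent2_sum X_indep n mf).
have := step _ _ v b s a ind (measurable_partial_sum n) (mean0 n) (mean2 n)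
  (mean3 n) s0.
have sv0 : 0 < s + v by rewrite ltr_pwDl.
have := IH (s + v) a sv0.
have -> : s + v + n%:R * v = s + n.+1%:R * v by rewrite -[n.+1%:R]natr1; ring.
under [in X in _ -> _ -> X]eq_Rintegral do rewrite big_ord_recr/=.
rewrite -[n.+1%:R]natr1.
set e := C1 * b / _ + _; set e' := C1 * b / _ + _ => H1 H2.
have s_le : s <= s + v by rewrite lerDl.
have r_le : Num.sqrt s <= Num.sqrt (s + v) by rewrite ler_sqrt// ltW.
have ee' : e <= e'.
  rewrite /e /e' lerD// ler_wpM2l ?mulr_ge0 ?sqr_ge0//.
    rewrite lef_pV2 ?posrE ?exprn_gt0 ?sqrtr_gt0//.
    by rewrite lerXn2r ?nnegrE ?sqrtr_ge0.
  by rewrite lef_pV2 ?posrE ?exprn_gt0// lerXn2r ?nnegrE ?(ltW s0) ?(ltW sv0).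
rewrite -(subrKA (\int[P]_w Phi ((a - S n w) / Num.sqrt (s + v)))).
rewrite (_ : _ * e' = e' + n%:R * e'); last by ring.
rewrite (le_trans (ler_normD _ _))// lerD//.
by rewrite (le_trans H1)// ler_wpM2l.
Qed.

(** Rescaling by [r = Num.sqrt n%:R]: at level [s = (r * eps) ^+ 2] the accumulated errors are of
    order 1/r and 1/r^2, together at most [K / r] once [r >= 1]. *)
Lemma smoothed_clt (eps y e : R) : 0 < eps -> 0 < e -> \forall n \near \oo,
  `|\int[P]_w Phi ((y - S n w / Num.sqrt n%:R) / eps) -
    Phi (y / Num.sqrt (eps ^+ 2 + v))| <= e.
Proof.
move=> eps0 e0; have [C1 [C2 [C10 C20 lind]]] := lindeberg.
have v0 := second_moment_ge0; have b0 := abs_moment_ge0.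
pose K := C1 * b / eps ^+ 3 + C2 * v ^+ 2 / eps ^+ 4.
near=> n.
have n1 : 1 <= n%:R :> R by near: n; exact: nbhs_infty_ger.
have n0 : 0 < n%:R :> R by rewrite (lt_le_trans _ n1).
have rK : K / e <= Num.sqrt n%:R by near: n; exact: near_sqrt_ge.
set r := Num.sqrt (n%:R : R); rewrite -/r in rK.
have r1 : 1 <= r by rewrite /r -[leLHS]sqrtr1 ler_sqrt.
have r0 : 0 < r by rewrite (lt_le_trans _ r1).
have nr : n%:R = r ^+ 2 :> R by rewrite sqr_sqrtr ?ltW.
have re0 : 0 < r * eps by rewrite mulr_gt0.
have s0 : 0 < (r * eps) ^+ 2 by rewrite exprn_gt0.
have := lind n ((r * eps) ^+ 2) (r * y) s0.
rewrite sqrtr_sqr (gtr0_norm re0) nr.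
rewrite (_ : (r * eps) ^+ 2 + r ^+ 2 * v = r ^+ 2 * (eps ^+ 2 + v)); last by ring.
rewrite sqrtrM ?sqr_ge0// sqrtr_sqr (gtr0_norm r0) -mulf_div divff ?gt_eqF// mul1r.
under eq_Rintegral => w _.
  rewrite (_ : (r * y - S n w) / (r * eps) = (y - S n w / r) / eps); last first.
    by field; rewrite !gt_eqF.
  over.
move=> /le_trans; apply.
apply: (@le_trans _ _ (K / r)); last by rewrite ler_pdivrMr// mulrC -ler_pdivrMr.
rewrite (_ : r ^+ 2 * _ = C1 * b / eps ^+ 3 / r + C2 * v ^+ 2 / eps ^+ 4 / r ^+ 2).
  rewrite /K mulrDl lerD// ler_wpM2l//.
    by rewrite mulr_ge0 ?invr_ge0 ?mulr_ge0 ?exprn_ge0// ltW.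
  by rewrite lef_pV2 ?posrE ?exprn_gt0// expr2 ler_peMr// ltW.
by field; rewrite !gt_eqF.
Unshelve. all: by end_near. Qed.

End lindeberg.

(** * Central limit theorem with a negligible perturbation *)

Lemma indic_bool (T : Type) (R : pzRingType) (p : pred T) w :
  \1_[set w | p w] w = (p w)%:R :> R.
Proof. by rewrite indicE; congr ((_ : bool)%:R); apply/idP/idP; rewrite inE. Qed.

Section sandwich.
Context {R : realType}.
Local Notation Phi := (@ncdf R 1).
Variables (z s x k eps : R).
Hypothesis eps0 : 0 < eps.

(** If [z] and [s] differ by less than [k * eps] and [z <= x], then [s < x + k * eps]. In the shift
    [2 * k], one [k] absorbs the distance from [z] to [s] and the other pushes the argument of [Phi]
    beyond [k], where [Phi] is nearly 1. [ncdf_le_indic] is the mirror image. *)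
Lemma indic_le_ncdf :
  (z <= x)%R%:R <= (k * eps <= `|z - s|)%R%:R +
    Phi ((x + (2 * k) * eps - s) / eps) + (1 - Phi k).
Proof.
have k1 := ncdf_le1 1 k; have P0 := ncdf_ge0 1 ((x + 2 * k * eps - s) / eps).
have [_|] := leP (k * eps) _; first by case: (z <= x)%R => /=; lra.
rewrite ltr_norml => /andP[zs _].
have [zx|_] /= := leP z x; last by lra.
have : Phi k <= Phi ((x + 2 * k * eps - s) / eps).
  by apply: ncdf_homo; rewrite ler_pdivlMr//; lra.
by lra.
Qed.

Lemma ncdf_le_indic :
  Phi ((x + - (2 * k) * eps - s) / eps) <=
  (z <= x)%R%:R + (k * eps <= `|z - s|)%R%:R + Phi (- k).
Proof.
have k0 := ncdf_ge0 1 (- k).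
have P1 := ncdf_le1 1 ((x + - (2 * k) * eps - s) / eps).
have [_|] := leP (k * eps) _; first by case: (z <= x)%R => /=; lra.
rewrite ltr_norml => /andP[_ zs].
have [_|zx] /= := leP z x; first by lra.
have : Phi ((x + - (2 * k) * eps - s) / eps) <= Phi (- k).
  by apply: ncdf_homo; rewrite ler_pdivrMr//; lra.
by lra.
Qed.

End sandwich.

Section perturbed_clt.
Context d (T : measurableType d) (R : realType) (P : probability T R).
Variables (X : nat -> {RV P >-> R}) (f : R -> R) (v b : R).
Hypothesis X_indep : mutually_independent P X.
Hypothesis mf : measurable_fun setT f.
Hypothesis mean0 : forall i, has_mean P (fun w => f (X i w)) 0.
Hypothesis mean2 : forall i, has_mean P (fun w => f (X i w) ^+ 2) v.
Hypothesis mean3 : forall i, has_mean P (fun w => `|f (X i w)| ^+ 3) b.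
Hypothesis v0 : 0 < v.

Local Notation S n w := ((\sum_(i < n) f (X i w)) / Num.sqrt n%:R).
Local Notation Phi := (@ncdf R 1).

Variable Z : nat -> {RV P >-> R}.
Hypothesis ZS : forall delta e : R, 0 < delta -> 0 < e -> \forall n \near \oo,
  fine (P [set w | delta <= `|Z n w - S n w|]) <= e.

Let Phi_tails (e : R) : 0 < e ->
  exists k : R, [/\ 0 < k, Phi (- k) <= e & 1 - Phi k <= e].
Proof.
move=> e0; have := @ncdf_cvgNy R 1.
rewrite cvgNy_compNP => /cvgrPdist_le/(_ e e0) HN.
have /cvgrPdist_le/(_ e e0) Hy := @ncdf_cvgy R 1.
near (+oo : set_system R) => k; exists k; split.
- by near: k; exact: nbhs_pinfty_gt.
- have : `|0 - Phi (- k)| <= e by near: k.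
  by rewrite sub0r normrN ger0_norm ?ncdf_ge0.
- have : `|1 - Phi k| <= e by near: k.
  by rewrite ger0_norm ?subr_ge0 ?ncdf_le1.
Unshelve. all: by end_near. Qed.

(** Letting [eps] tend to 0 removes both the shift and the variance added by the smoothing; [v > 0]
    gives continuity of the quotient at 0. *)
Let shifted_limit (x c e : R) : 0 < e -> \forall eps \near 0^'+,
  `|Phi ((x + c * eps) / Num.sqrt (eps ^+ 2 + v)) - Phi (x / Num.sqrt v)| <= e.
Proof.
move=> e0.
have : Phi ((x + c * eps) / Num.sqrt (eps ^+ 2 + v)) @[eps --> 0^'+] -->
    Phi ((x + c * 0) / Num.sqrt (0 ^+ 2 + v)).
  apply: cvg_at_right_filter.
  have cPhi : continuous Phi.
    move=> y; apply: differentiable_continuous; apply/derivable1_diffP.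
    by have [] := is_derive_ncdf y (oner_neq0 R).
  pose g (z : R) := (x + c * z) / Num.sqrt (z ^+ 2 + v).
  have cg : {for 0, continuous g}.
    apply: cvgM.
      by apply: cvgD; [exact: cvg_cst|apply: cvgM; [exact: cvg_cst|exact: cvg_id]].
    apply: cvgV; first by rewrite gt_eqF// sqrtr_gt0 expr0n add0r.
    apply: continuous_comp; last exact: sqrt_continuous.
    by apply: cvgD; [exact: exprn_continuous|exact: cvg_cst].
  exact: (continuous_comp cg (cPhi _)).
rewrite mulr0 addr0 expr0n/= add0r => /cvgrPdist_le/(_ e e0).
by apply: filterS => eps; rewrite distrC.
Qed.

(** The error budget: on each side one quarter for the tail of [Phi], the event where the
    perturbation is large, the effect of shift and smoothing on the limit, and the smoothed limit
    theorem. *)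
Let quarters (e p pp pm kN ky F Bd Ip Im : R) : kN <= e / 4 -> 1 - ky <= e / 4 ->
  Bd <= e / 4 -> `|pp - p| <= e / 4 -> `|pm - p| <= e / 4 ->
  `|Ip - pp| <= e / 4 -> `|Im - pm| <= e / 4 ->
  F <= Bd + Ip + (1 - ky) -> Im <= F + Bd + kN -> `|F - p| <= e.
Proof.
move=> ? ? ?; rewrite !ler_norml.
do 4 move=> /andP[? ?]; move=> ? ?; apply/andP; split; lra.
Qed.

Let mZS n : measurable_fun setT (fun w => Z n w - S n w).
Proof.
apply: measurable_funB => //; apply: measurable_funM => //.
by apply: measurable_sum => i; exact: measurableT_comp.
Qed.

Let mbad n (delta : R) : measurable [set w | delta <= `|Z n w - S n w|].
Proof.
rewrite -[X in measurable X]setTI.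
apply: measurable_fun_le => //.
exact: (measurableT_comp (@normr_measurable _ setT) (mZS n)).
Qed.

Let mcdf n (x : R) : measurable [set w | Z n w <= x].
Proof.
rewrite (_ : [set w | Z n w <= x] = Z n @^-1` `]-oo, x]); last first.
  by apply/seteqP; split => w /=; rewrite in_itv.
by rewrite -[X in measurable X]setTI; exact: measurable_funP. Qed.

(** The order of choices matters: [k] from the tails of [Phi], then [eps] small depending on [k],
    then [n] large depending on both. The tolerated perturbation [delta = k * eps] is thus fixed
    before [n]. *)
Lemma perturbed_clt_near (x e : R) : 0 < e -> \forall n \near \oo,
  `|fine (cdf (Z n) x) - Phi (x / Num.sqrt v)| <= e.
Proof.
move=> e0; have e4 : 0 < e / 4 by rewrite divr_gt0.
have [k [k0 kN ky]] := Phi_tails e4.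
near (0 : R)^'+ => eps.
have eps0 : 0 < eps by near: eps; exact: nbhs_right_gt.
pose delta := k * eps; have delta0 : 0 < delta by rewrite mulr_gt0.
have Hp : `|Phi ((x + (2 * k) * eps) / Num.sqrt (eps ^+ 2 + v)) -
    Phi (x / Num.sqrt v)| <= e / 4 by near: eps; exact: shifted_limit.
have Hm : `|Phi ((x + (- (2 * k)) * eps) / Num.sqrt (eps ^+ 2 + v)) -
    Phi (x / Num.sqrt v)| <= e / 4 by near: eps; exact: shifted_limit.
have Cp := smoothed_clt X_indep mf mean0 mean2 mean3 (x + (2 * k) * eps) eps0 e4.
have Cm := smoothed_clt X_indep mf mean0 mean2 mean3 (x + (- (2 * k)) * eps) eps0 e4.
have B := ZS delta0 e4.
near=> n.
have B' : fine (P [set w | delta <= `|Z n w - S n w|]) <= e / 4 by near: n.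
have : `|\int[P]_w Phi ((x + (2 * k) * eps - S n w) / eps) -
  Phi ((x + (2 * k) * eps) / Num.sqrt (eps ^+ 2 + v))| <= e / 4 by near: n.
have : `|\int[P]_w Phi ((x + (- (2 * k)) * eps - S n w) / eps) -
  Phi ((x + (- (2 * k)) * eps) / Num.sqrt (eps ^+ 2 + v))| <= e / 4 by near: n.
have mSh c : measurable_fun setT (fun w => (c - S n w) / eps).
  apply: measurable_funM => //; apply: measurable_funB => //.
  apply: measurable_funM => //.
  by apply: measurable_sum => i; exact: measurableT_comp.
have Ep := has_mean_ncdf P (mSh (x + (2 * k) * eps)).
have Em := has_mean_ncdf P (mSh (x + (- (2 * k)) * eps)).
have EB := has_mean_indic P (mbad n delta).
have EZ := has_mean_indic P (mcdf n x).
have upper := has_mean_le EZ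
  (has_meanD (has_meanD EB Ep) (has_mean_cst P (1 - Phi k))).
have lower := has_mean_le Em
  (has_meanD (has_meanD EZ EB) (has_mean_cst P (Phi (- k)))).
have cdfE : cdf (Z n) x = P [set w | Z n w <= x].
  by congr (P _); apply/seteqP; split => w /=; rewrite in_itv.
have {}upper : fine (cdf (Z n) x) <= fine (P [set w | delta <= `|Z n w - S n w|])
    + \int[P]_w Phi ((x + (2 * k) * eps - S n w) / eps) + (1 - Phi k).
  rewrite cdfE; apply: upper => w; rewrite (indic_bool R (fun w => Z n w <= x)).
  by rewrite (indic_bool R (fun w => delta <= `|Z n w - S n w|)) indic_le_ncdf.
have {}lower : \int[P]_w Phi ((x + (- (2 * k)) * eps - S n w) / eps) <=
    fine (cdf (Z n) x) + fine (P [set w | delta <= `|Z n w - S n w|]) + Phi (- k).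
  rewrite cdfE; apply: lower => w; rewrite (indic_bool R (fun w => Z n w <= x)).
  by rewrite (indic_bool R (fun w => delta <= `|Z n w - S n w|)) ncdf_le_indic.
move=> Im Ip; exact: (quarters kN ky B' Hp Hm Ip Im upper lower).
Unshelve. all: by end_near. Qed.

Lemma perturbed_clt : cvg_in_distribution P Z (normal_prob 0 (Num.sqrt v)).
Proof.
move=> x _; rewrite -[X in _ --> X]/(normal_prob 0 (Num.sqrt v) `]-oo, x]).
rewrite ncdf_fin ncdf_scale ?sqrtr_gt0//.
have -> : (fun n => cdf (Z n) x) = (fun n => (fine (cdf (Z n) x))%:E).
  by apply/funext => n; rewrite fineK// fin_num_measure.
apply: cvg_EFin; first by near=> n.
apply/cvgrPdist_le => e e0; near=> n; rewrite distrC.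
by near: n; exact: perturbed_clt_near.
Unshelve. all: by end_near. Qed.

End perturbed_clt.

(** * Moments of the Pareto distribution *)

Section log_power_integral.
Context {R : realType}.
Local Notation mu := (@lebesgue_measure R).
Implicit Types (g x : R) (j : nat).

(* Antiderivative of x `^ (- g - 1) * ln x ^+ j, by repeated integration by
   parts. *)
Fixpoint log_power_primitive g j x : R :=
  if j is i.+1 then
    - (x `^ (- g) * ln x ^+ j) / g + j%:R / g * log_power_primitive g i x
  else - x `^ (- g) / g.

Lemma is_derive_log_power_primitive g j x : 0 < g -> 0 < x ->
  is_derive x 1 (log_power_primitive g j) (x `^ (- g - 1) * ln x ^+ j).
Proof.
move=> g0 x0; have gn0 : g != 0 by rewrite gt_eqF.
have xn0 : x != 0 by rewrite gt_eqF.
have dp := @is_derive1_powR R (- g) x x0; have dl := is_derive1_ln x0.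
elim: j => [|j IH] /=.
  by apply: is_derive_eq; rewrite /GRing.scale/= expr0; field.
have dlj := is_deriveX j.+1 dl; rewrite exprfctE in dlj.
have := is_deriveD (is_deriveZ (- g^-1) (is_deriveM dp dlj))
  (is_deriveZ (j.+1%:R / g) IH).
rewrite (_ : _ \*: _ + _ = log_power_primitive g j.+1); last first.
  apply/funext => y; rewrite -[LHS]/(- g^-1 * (y `^ (- g) * ln y ^+ j.+1) +
    j.+1%:R / g * log_power_primitive g j y) /=; ring.
move=> /is_derive_eq; apply; rewrite /GRing.scale/= /GRing.scale/=.
rewrite (_ : x `^ (- g) = x `^ (- g - 1) * x); last first.
  by rewrite -[X in _ * X]powRr1 ?ltW// -powRD ?subrK//; apply/implyP.
by rewrite exprS /=; field; rewrite gn0.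
Qed.

(** The term of order [j.+1] in the exponential series bounds [expR (g * ln x)] from below, so the
    product is at most [K / ln x]. *)
Lemma powRN_ln_cvg0 g j : 0 < g -> x `^ (- g) * ln x ^+ j @[x --> +oo] --> (0 : R).
Proof.
move=> g0.
pose K := j.+1`!%:R / g ^+ j.+1.
apply/cvgrPdist_le => e e0; near=> x.
have x1 : 1 < x by near: x; exact: nbhs_pinfty_gt.
have x0 : 0 < x by rewrite (lt_trans _ x1).
have lx : 0 < ln x by rewrite ln_gt0.
have lK : K / e <= ln x.
  rewrite -ler_expR lnK//; near: x; apply: nbhs_pinfty_ge; exact: num_real.
rewrite sub0r normrN ger0_norm; last first.
  by rewrite mulr_ge0 ?powR_ge0// exprn_ge0 ?(ltW lx).
rewrite powRN /powR gt_eqF// mulrC ler_pdivrMr ?expR_gt0//.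
have := expR_ge1Dxn j (ltW (mulr_gt0 g0 lx)); move: (expR _) => E HE.
have {}HE : (g * ln x) ^+ j.+1 / j.+1`!%:R <= E by lra.
rewrite -ler_pdivrMl//; apply: le_trans HE.
rewrite exprMn [ln x ^+ j.+1]exprS ler_pdivlMr ?ltr0n ?fact_gt0//.
rewrite (mulrAC e^-1) [leRHS]mulrA ler_wpM2r ?exprn_ge0 ?(ltW lx)//.
move: lK; rewrite /K ler_pdivrMr// ler_pdivrMr ?exprn_gt0// => H.
rewrite ler_pdivrMl//; apply: le_trans H _; rewrite le_eqVlt; apply/orP; left.
by apply/eqP; ring.
Unshelve. all: by end_near. Qed.

Lemma log_power_primitive_cvg0 g j : 0 < g ->
  log_power_primitive g j x @[x --> +oo] --> (0 : R).
Proof.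
move=> g0; elim: j => [|j IH] /=.
  rewrite -[X in _ --> X](mul0r g^-1); apply: cvgM; last exact: cvg_cst.
  rewrite -oppr0; apply: cvgN; have := powRN_ln_cvg0 0 g0.
  by under eq_fun do rewrite expr0 mulr1.
rewrite (_ : 0 = - 0 / g + j.+1%:R / g * 0 :> R); last first.
  by rewrite mulr0 oppr0 mul0r addr0.
apply: cvgD; apply: cvgM => //; try exact: cvg_cst.
by apply: cvgN; exact: powRN_ln_cvg0.
Qed.

Lemma log_power_primitive1 g j : 0 < g ->
  log_power_primitive g j 1 = - (j`!%:R / g ^+ j.+1).
Proof.
move=> g0; have gn0 : g != 0 by rewrite gt_eqF.
elim: j => [|j IH] /=; first by rewrite powR1 fact0 expr1 mulN1r div1r.
rewrite IH ln1 expr0n/= mulr0 oppr0 mul0r add0r factS natrM [g ^+ j.+2]exprS.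
by field; rewrite gn0 expf_neq0.
Qed.

(** In the variable y = ln x this is the Gamma integral of y^j exp(- g y); the explicit primitive
    avoids the change of variables. *)
Lemma integral_log_power g j : 0 < g ->
  (\int[mu]_(x in `[1%R, +oo[) (x `^ (- g - 1) * ln x ^+ j)%:E =
    (j`!%:R / g ^+ j.+1)%:E)%E.
Proof.
move=> g0.
have d x : 1 <= x ->
    is_derive x 1 (log_power_primitive g j) (x `^ (- g - 1) * ln x ^+ j).
  by move=> x1; apply: is_derive_log_power_primitive; rewrite ?(lt_le_trans _ x1).
pose f (x : R) := x `^ (- g - 1) * ln x ^+ j.
have cf : {within `[1%R, +oo[, continuous f}.
  apply: derivable_within_continuous => x; rewrite in_itv/= andbT => x1.
  have x0 : 0 < x by rewrite (lt_le_trans _ x1).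
  have [dp _] := @is_derive1_powR R (- g - 1) x x0.
  have [dl _] := is_derive1_ln x0.
  apply: (derivableM dp).
  by rewrite -exprfctE; exact: derivableX.
rewrite (@ge0_continuous_FTC2y _ f (log_power_primitive g j) 1 0).
- by rewrite sub0e log_power_primitive1// -EFinN opprK.
- by move=> x x1; rewrite mulr_ge0 ?powR_ge0// exprn_ge0// ln_ge0.
- exact: cf.
- exact: log_power_primitive_cvg0.
- by move=> x /ltW /d [].
- apply: cvg_at_right_filter; apply: differentiable_continuous.
  by apply/derivable1_diffP; have [] := d 1 (lexx 1).
- move=> x; rewrite in_itv/= andbT => /ltW /d [dx dE].
  by rewrite derive1E.
Qed.

End log_power_integral.

(** * Integration against a density *)

Section density.
Context {R : realType}.
Local Notation mu := (@lebesgue_measure R).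
Local Open Scope ereal_scope.

(** The density [p] and the Radon-Nikodym derivative of [nu] have equal integrals over every
    measurable set, hence agree almost everywhere. *)
Lemma ge0_integral_density (nu : {finite_measure set (measurableTypeR R) -> \bar R})
    (p : R -> R) (h : R -> \bar R) :
  measurable_fun setT p -> (forall x, 0 <= p x)%R ->
  (forall A, measurable A -> nu A = \int[mu]_(x in A) (p x)%:E) ->
  measurable_fun setT h -> (forall x, 0 <= h x) ->
  \int[nu]_x h x = \int[mu]_x (h x * (p x)%:E).
Proof.
move=> mp p0 nuE mh h0.
have numu : nu `<< mu.
  apply/null_content_dominatesP => A mA muA0; rewrite nuE//.
  by apply: null_set_integral => //; apply: measurable_funTS; exact/measurable_EFinP.
rewrite -(Radon_Nikodym_SigmaFinite.change_of_variables numu)//.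
pose g := Radon_Nikodym_SigmaFinite.f nu mu.
have ig : mu.-integrable setT g.
  exact: Radon_Nikodym_SigmaFinite.f_integrable.
have mg := measurable_int _ ig.
apply: ge0_ae_eq_integral => //.
- exact: emeasurable_funM.
- by apply: emeasurable_funM => //; exact/measurable_EFinP.
- by move=> x _; rewrite mule_ge0//; exact: Radon_Nikodym_SigmaFinite.f_ge0.
- by move=> x _; rewrite mule_ge0// lee_fin.
apply: ae_eqe_mul2l; apply: integral_ae_eq => //; first exact/measurable_EFinP.
move=> A _ mA; rewrite -nuE//.
by rewrite -Radon_Nikodym_SigmaFinite.f_integral.
Qed.

End density.

Section pareto_moments.
Context d (T : measurableType d) (R : realType) (P : probability T R).
Variables (alpha : R) (X : {RV P >-> R}).
Hypothesis alpha0 : 0 < alpha.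
Hypothesis lawX : forall A : set R, measurable A ->
  distribution P X A = pareto_prob alpha A.
Local Notation mu := (@lebesgue_measure R).

(* Lebesgue measure lives on measurableTypeR R, whose display differs from that
   of the canonical Borel structure on R. *)
Let XT : T -> measurableTypeR R := X.

Let mXT : measurable_fun [set: T] XT.
Proof. by move=> _ A mA; exact: (@measurable_funPT _ _ _ _ X). Qed.

#[local] HB.instance Definition _ := @isMeasurableFun.Build _ _ _ _ XT mXT.

Lemma pareto_pdf_ge0 x : 0 <= pareto_pdf alpha x.
Proof.
rewrite /pareto_pdf patchE; case: ifPn => // _.
by rewrite mulr_ge0 ?powR_ge0// ltW.
Qed.

Lemma measurable_pareto_pdf : measurable_fun setT (pareto_pdf alpha).
Proof.
apply/(measurable_restrictT _ _).1 => //; apply: measurable_funTS.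
by apply: measurable_funM => //; exact: measurable_powR.
Qed.

Lemma pareto_ae_ge1 : P (X @^-1` `]-oo, 1[) = 0%E.
Proof.
rewrite -[LHS]/(distribution P X _) lawX// /pareto_prob integral0_eq// => x.
rewrite /= in_itv/= => x1; rewrite /pareto_pdf patchE ifF//.
by rewrite memNset//= in_itv/= andbT leNgt x1.
Qed.

Lemma ge0_integral_pareto (g : R -> R) : measurable_fun setT g ->
  (forall x, 0 <= g x) ->
  (\int[P]_w (g (X w))%:E = \int[mu]_x ((g x)%:E * (pareto_pdf alpha x)%:E))%E.
Proof.
move=> mg g0; have mgE : measurable_fun setT (EFin \o g) by exact/measurable_EFinP.
rewrite -[LHS](@ge0_integral_distribution _ _ _ _ _ P
  (XT : {mfun T >-> measurableTypeR R}) (EFin \o g))//.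
exact: (@ge0_integral_density R (distribution P (XT : {mfun T >-> measurableTypeR R}))
  (pareto_pdf alpha) _ measurable_pareto_pdf pareto_pdf_ge0 lawX mgE g0).
Qed.

Definition log_monomial j b (x : R) : R := ln x ^+ j * (x^-1) ^+ b.

Lemma measurable_log_monomial j b : measurable_fun setT (log_monomial j b).
Proof.
apply: measurable_funM; apply: measurable_funX; first exact: measurable_ln.
exact: measurable_invr.
Qed.

(** The factor [x^-1 ^+ b] changes [alpha] into [alpha + b%:R] in the exponent of the density,
    leaving a log-power integral. Integration of nonnegative functions yields the mean of the
    absolute value first; the absolute value is then removed because [X >= 1] holds almost surely,
    though perhaps not everywhere. *)
Lemma pareto_moment j b : has_mean P (fun w => log_monomial j b (X w))
  (alpha * j`!%:R / (alpha + b%:R) ^+ j.+1).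
Proof.
set h := log_monomial j b; have mh := measurable_log_monomial j b.
have g0 : 0 < alpha + b%:R by rewrite ltr_pwDl.
have mhX : measurable_fun setT (fun w => h (X w)) by exact: measurableT_comp.
have absE : (\int[P]_w `|h (X w)|%:E =
    (alpha * j`!%:R / (alpha + b%:R) ^+ j.+1)%:E)%E.
  rewrite (@ge0_integral_pareto (fun x => `|h x|))//; last exact: measurableT_comp.
  rewrite -mulrA EFinM -integral_log_power// -ge0_integralZl//; first last.
  - by rewrite lee_fin ltW.
  - move=> x; rewrite /= in_itv/= andbT => x1.
    by rewrite lee_fin mulr_ge0 ?powR_ge0// exprn_ge0// ln_ge0.
  - apply/measurable_EFinP; apply: measurable_funTS.
    apply: measurable_funM; first exact: measurable_powR.
    by apply: measurable_funX; exact: measurable_ln.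
  rewrite [RHS]integral_mkcond; apply: eq_integral => x _.
  rewrite /pareto_pdf !patchE; case: ifPn => [|_]; last by rewrite mule0.
  rewrite inE/= in_itv/= andbT => x1; have x0 : 0 < x := lt_le_trans ltr01 x1.
  rewrite -!EFinM ger0_norm; last first.
    by rewrite mulr_ge0 ?exprn_ge0 ?ln_ge0// invr_ge0 ltW.
  have -> : x `^ (- (alpha + b%:R) - 1) = x `^ (- alpha - 1) * x^-1 ^+ b.
    rewrite opprD addrAC powRD; last by apply/implyP => _; rewrite gt_eqF.
    by rewrite [x `^ (- b%:R)]powRN powR_mulrn ?(ltW x0)// exprVn.
  by congr EFin; rewrite /h /log_monomial; ring.
have ihX : P.-integrable setT (EFin \o (fun w => h (X w))).
  apply/integrableP; split; first exact/measurable_EFinP.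
  by rewrite /= absE ltry.
split=> //; rewrite /Rintegral.
have -> : (\int[P]_w (h (X w))%:E = \int[P]_w `|h (X w)|%:E)%E; last by rewrite absE.
apply: ae_eq_integral => //.
- exact/measurable_EFinP.
- by apply/measurable_EFinP; exact: measurableT_comp.
exists (X @^-1` `]-oo, 1[); split.
- by rewrite -[X in measurable X]setTI; exact: measurable_funP.
- exact: pareto_ae_ge1.
move=> w /=; rewrite in_itv/= => /not_implyP[_]; apply: contra_notP => /negP.
rewrite -leNgt => x1; rewrite ger0_norm// mulr_ge0 ?exprn_ge0 ?ln_ge0//.
by rewrite invr_ge0 (le_trans ler01).
Qed.

End pareto_moments.

(** * Linearization of the statistic *)

Section linearization.
Context {R : realType}.
Variable alpha : R.
Hypothesis alpha0 : 0 < alpha.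

Local Notation a := (alpha + 1).
Local Notation m := (alpha / (alpha + 1) ^+ 2).

(* Influence function of the statistic: its first-order expansion around the
   means alpha^-1, m and alpha / (alpha + 1) of ln X, ln X / X and 1 / X. *)
Definition influence (x : R) : R :=
  a * (ln x * x^-1) - x^-1 - alpha ^+ 3 / a ^+ 2 * ln x + alpha ^+ 2 / a ^+ 2.

Definition log_dev (x : R) : R := 1 - alpha * ln x.

Definition ratio_dev (x : R) : R := ln x * x^-1 - m.

(** For sample means, the estimator minus [alpha] is (1 - alpha L) / L. Multiplying it by M and
    subtracting the linear part alpha m (1 - alpha L) leaves (1 - alpha L) / L times M - alpha m L,
    and the latter is (M - m) + m (1 - alpha L). *)
Lemma sqrtn_DS1_linearization n (x : 'I_n -> R) : (0 < n)%N ->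
  \sum_(i < n) ln (x i) != 0 ->
  Num.sqrt n%:R * DS1 x - (\sum_(i < n) influence (x i)) / Num.sqrt n%:R =
  (\sum_(i < n) log_dev (x i)) / (\sum_(i < n) ln (x i)) *
  (\sum_(i < n) ratio_dev (x i) + m * \sum_(i < n) log_dev (x i)) / Num.sqrt n%:R.
Proof.
move=> n0 L0; rewrite /DS1 /pareto_mle.
pose L := \sum_(i < n) ln (x i); pose M := \sum_(i < n) ln (x i) / x i.
pose K := \sum_(i < n) (x i)^-1.
have -> : \sum_(i < n) influence (x i) =
    a * M - K - alpha ^+ 3 / a ^+ 2 * L + n%:R * (alpha ^+ 2 / a ^+ 2).
  rewrite /influence big_split/= sumrB sumrB -mulr_sumr -mulr_sumr.
  by rewrite sumr_const card_ord mulr_natl.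
have -> : \sum_(i < n) log_dev (x i) = n%:R - alpha * L.
  by rewrite /log_dev sumrB -mulr_sumr sumr_const card_ord.
have -> : \sum_(i < n) ratio_dev (x i) = M - n%:R * m.
  by rewrite /ratio_dev sumrB sumr_const card_ord mulr_natl.
rewrite -/L -/M -/K; rewrite -/L in L0.
have a0 : a != 0 by rewrite gt_eqF// addr_gt0.
have : Num.sqrt (n%:R : R) != 0 by rewrite gt_eqF// sqrtr_gt0 ltr0n.
have -> : (n%:R : R) = Num.sqrt n%:R ^+ 2 by rewrite sqr_sqrtr.
rewrite sqrtr_sqr ger0_norm ?sqrtr_ge0//.
move: (Num.sqrt _) L M K L0 => r L M K L0 r0.
by field; rewrite L0 a0 r0.
Qed.

(** With [t <= 1 / 2] the bound on [U] forces [alpha * L >= n / 2], which keeps the denominator away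
    from 0. Then [U / L] is at most [2 * alpha * t] in absolute value, and the other factor is at
    most [(1 + m) * t * n]. *)
Lemma linearization_error (n : nat) (L U Q t : R) : (0 < n)%N -> 0 <= t <= 1 / 2 ->
  U = n%:R - alpha * L -> `|U| <= t * n%:R -> `|Q| <= t * n%:R ->
  L != 0 /\ `|U / L * (Q + m * U) / Num.sqrt n%:R| <=
    2 * alpha * (1 + m) * (t ^+ 2 * Num.sqrt n%:R).
Proof.
move=> n0 /andP[t0 t1] UE Ut Qt.
have nR0 : 0 < n%:R :> R by rewrite ltr0n.
have m0 : 0 <= m by rewrite divr_ge0 ?exprn_ge0 ?ltW// addr_gt0.
have L_ge : n%:R / (2 * alpha) <= L.
  rewrite ler_pdivrMr ?mulr_gt0//.
  by move: Ut; rewrite ler_norml => /andP[_]; rewrite UE; nra.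
have L0 : 0 < L by rewrite (lt_le_trans _ L_ge)// divr_gt0// mulr_gt0.
split; first by rewrite gt_eqF.
set r := Num.sqrt n%:R; have r0 : 0 < r by rewrite sqrtr_gt0.
have nr : n%:R = r ^+ 2 by rewrite sqr_sqrtr// ltW.
rewrite !normrM !normfV (gtr0_norm L0) (gtr0_norm r0) ler_pdivrMr//.
have LV : L^-1 <= 2 * alpha / n%:R.
  by rewrite -[leRHS]invrK invf_div lef_pV2 ?posrE// divr_gt0// mulr_gt0.
have QU : `|Q + m * U| <= (1 + m) * (t * n%:R).
  rewrite (le_trans (ler_normD _ _))// normrM (ger0_norm m0) mulrDl mul1r.
  by rewrite lerD// ler_wpM2l.
have ULV : `|U| / L <= (t * n%:R) * (2 * alpha / n%:R).
  by rewrite ler_pM// invr_ge0 ltW.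
apply: (le_trans (ler_pM _ _ ULV QU)) => //; first by rewrite divr_ge0// ltW.
rewrite nr le_eqVlt; apply/orP; left; apply/eqP; field.
by apply/andP; split; rewrite gt_eqF// addr_gt0.
Qed.

Lemma measurable_influence : measurable_fun setT influence.
Proof.
have mln := @measurable_ln R; have mV := @measurable_invr R.
apply: measurable_funD => //; apply: measurable_funB.
  apply: measurable_funB => //; apply: measurable_funM => //.
  exact: measurable_funM.
exact: measurable_funM.
Qed.

Lemma measurable_log_dev : measurable_fun setT log_dev.
Proof.
by apply: measurable_funB => //; exact: measurable_funM.
Qed.

Lemma measurable_ratio_dev : measurable_fun setT ratio_dev.
Proof.
apply: measurable_funB => //; apply: measurable_funM; first exact: measurable_ln.
exact: measurable_invr.
Qed.

Definition asymptotic_variance : R :=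
  alpha * (2 + (2 * alpha + alpha ^+ 2) * (5 + 8 * alpha + 4 * alpha ^+ 2)) /
    ((2 + alpha) ^+ 3 * (1 + alpha) ^+ 4).

Lemma asymptotic_variance_gt0 : 0 < asymptotic_variance.
Proof.
rewrite divr_gt0//; last by rewrite mulr_gt0// exprn_gt0// addr_gt0.
rewrite mulr_gt0// addr_gt0// mulr_gt0// ?addr_gt0// ?mulr_gt0// exprn_gt0//.
Qed.

Section moments.
Context d (T : measurableType d) (P : probability T R) (X : {RV P >-> R}).
Hypothesis lawX : forall A : set R, measurable A ->
  distribution P X A = pareto_prob alpha A.

Let mom j b := pareto_moment alpha0 lawX j b.

Lemma influence_mean : has_mean P (fun w => influence (X w)) 0.
Proof.
apply: (has_mean_congr _ _ (has_meanD (has_meanB (has_meanB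
  (has_meanZ a (mom 1 1)) (mom 0 1))
  (has_meanZ (alpha ^+ 3 / a ^+ 2) (mom 1 0)))
  (has_mean_cst P (alpha ^+ 2 / a ^+ 2)))) => [w|].
  by rewrite /influence /log_monomial !expr0 !expr1 mul1r mulr1.
rewrite fact0 (_ : 1`! = 1%N)// addr0; field.
by apply/andP; split; rewrite gt_eqF// addr_gt0.
Qed.

Lemma influence_variance :
  has_mean P (fun w => influence (X w) ^+ 2) asymptotic_variance.
Proof.
pose c := alpha ^+ 3 / a ^+ 2; pose k := alpha ^+ 2 / a ^+ 2.
(* The ten terms of the square of a four-term sum. Two cross terms share the monomial [ln x / x]:
   [ln x / x] with the constant, and [1 / x] with [ln x]. *)
apply: (has_mean_congr _ _ (has_meanD (has_meanD (has_meanD (has_meanD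
 (has_meanD (has_meanD (has_meanD (has_meanD (has_meanD
  (has_meanZ (a ^+ 2) (mom 2 2)) (mom 0 2)) (has_meanZ (c ^+ 2) (mom 2 0)))
  (has_mean_cst P (k ^+ 2))) (has_meanZ (- 2 * a) (mom 1 2)))
  (has_meanZ (- 2 * a * c) (mom 2 1))) (has_meanZ (2 * a * k) (mom 1 1)))
  (has_meanZ (2 * c) (mom 1 1))) (has_meanZ (- 2 * k) (mom 0 1)))
  (has_meanZ (- 2 * c * k) (mom 1 0)))) => [w|].
  by rewrite /influence /log_monomial -/c -/k !expr0 !expr1; ring.
rewrite /asymptotic_variance /c /k fact0 (_ : 1`! = 1%N)// (_ : 2`! = 2%N)//.
rewrite addr0 (addrC 1 alpha) (addrC 2 alpha); field.
by apply/and3P; split; rewrite gt_eqF// addr_gt0.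
Qed.

Lemma log_dev_mean : has_mean P (fun w => log_dev (X w)) 0.
Proof.
apply: (has_mean_congr _ _ (has_meanB (has_mean_cst P 1)
  (has_meanZ alpha (mom 1 0)))) => [w|].
  by rewrite /log_dev /log_monomial expr0 expr1 mulr1.
by rewrite (_ : 1`! = 1%N)// addr0; field; rewrite gt_eqF.
Qed.

Lemma log_dev_variance : has_mean P (fun w => log_dev (X w) ^+ 2) 1.
Proof.
apply: (has_mean_congr _ _ (has_meanD (has_meanD (has_mean_cst P 1)
  (has_meanZ (- 2 * alpha) (mom 1 0))) (has_meanZ (alpha ^+ 2) (mom 2 0)))) => [w|].
  by rewrite /log_dev /log_monomial !expr0 !expr1; ring.
by rewrite (_ : 1`! = 1%N)// (_ : 2`! = 2%N)// addr0; field; rewrite gt_eqF.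
Qed.

Lemma ratio_dev_mean : has_mean P (fun w => ratio_dev (X w)) 0.
Proof.
apply: (has_mean_congr _ _ (has_meanB (mom 1 1) (has_mean_cst P m))) => [w|].
  by rewrite /ratio_dev /log_monomial !expr1.
by rewrite (_ : 1`! = 1%N)// mulr1 subrr.
Qed.

Lemma ratio_dev_variance : has_mean P (fun w => ratio_dev (X w) ^+ 2)
  (2 * alpha / (alpha + 2) ^+ 3 - m ^+ 2).
Proof.
apply: (has_mean_congr _ _ (has_meanD (has_meanD (mom 2 2)
  (has_meanZ (- 2 * m) (mom 1 1))) (has_mean_cst P (m ^+ 2)))) => [w|].
  by rewrite /ratio_dev /log_monomial; ring.
rewrite (_ : 1`! = 1%N)// (_ : 2`! = 2%N)//; field.
by apply/andP; split; rewrite gt_eqF// addr_gt0.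
Qed.

Let has_mean_norm_monomial j b :
  has_mean P (fun w => `|log_monomial j b (X w)|)
    (\int[P]_w `|log_monomial j b (X w)|).
Proof.
split => //; have [iX _] := mom j b.
exact: (integrable_norm iX).
Qed.

(** Only finiteness matters; writing the value as an integral against the density makes it the same
    for all indices. Splitting the four summands in pairs and then singly costs a factor 4 each
    time, whence the 16 in the majorant. *)
Lemma influence_third_moment :
  has_mean P (fun w => `|influence (X w)| ^+ 3)
    (fine (\int[lebesgue_measure]_x
      ((`|influence x| ^+ 3)%:E * (pareto_pdf alpha x)%:E)))%E.
Proof.
have mi3 : measurable_fun setT (fun x => `|influence x| ^+ 3).
  apply: measurable_funX; apply: (measurableT_comp (@normr_measurable _ setT)).
  exact: measurable_influence.
rewrite -(ge0_integral_pareto alpha0 lawX mi3); last by move=> x; rewrite exprn_ge0.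
pose c := alpha ^+ 3 / a ^+ 2; pose k := alpha ^+ 2 / a ^+ 2.
have a0 : 0 < a by rewrite addr_gt0.
have c0 : 0 <= c by rewrite divr_ge0// exprn_ge0// ltW.
have k0 : 0 <= k by rewrite divr_ge0// exprn_ge0// ltW.
have maj := has_meanZ 16 (has_meanD (has_meanD (has_meanD
  (has_meanZ (a ^+ 3) (has_mean_norm_monomial 3 3)) (has_mean_norm_monomial 0 3))
  (has_meanZ (c ^+ 3) (has_mean_norm_monomial 3 0))) (has_mean_cst P (k ^+ 3))).
apply: (dominated_has_mean _ maj) => [|w]; first exact: (measurableT_comp mi3).
rewrite ger0_norm ?exprn_ge0// /log_monomial !expr0 mul1r mulr1 -!exprMn !normrX.
have cube2 (p q : R) : 0 <= p -> 0 <= q -> (p + q) ^+ 3 <= 4 * (p ^+ 3 + q ^+ 3).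
  move=> p0 q0; rewrite -subr_ge0.
  rewrite (_ : _ - _ = 3 * (p + q) * (p - q) ^+ 2); last by ring.
  by rewrite mulr_ge0 ?sqr_ge0// mulr_ge0// addr_ge0.
set u := `|ln (X w) * _|; set v := `|_^-1|; set l := `|ln (X w)|.
have fle : `|influence (X w)| <= (a * u + v) + (c * l + k).
  rewrite /influence -/c -/k (le_trans (ler_normD _ _))// addrA lerD//; last first.
    by rewrite ger0_norm.
  rewrite (le_trans (ler_normB _ _))// lerD//; last by rewrite normrM ger0_norm.
  by rewrite (le_trans (ler_normB _ _))// lerD// normrM ger0_norm// ltW.
have au0 : 0 <= a * u by exact: mulr_ge0 (ltW a0) (normr_ge0 _).
have cl0 : 0 <= c * l by exact: mulr_ge0 c0 (normr_ge0 _).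
have p0 : 0 <= a * u + v by exact: addr_ge0 au0 (normr_ge0 _).
have q0 : 0 <= c * l + k by exact: addr_ge0.
have f3 : `|influence (X w)| ^+ 3 <= ((a * u + v) + (c * l + k)) ^+ 3.
  by rewrite lerXn2r// nnegrE; exact: addr_ge0.
apply: (le_trans f3); apply: (le_trans (cube2 _ _ p0 q0)).
have := cube2 _ _ au0 (normr_ge0 (X w)^-1); have := cube2 _ _ cl0 k0.
by rewrite -/v !exprMn; lra.
Qed.

End moments.

End linearization.

(** * Negligibility of the linearization error *)

Section slutsky.
Context d (T : measurableType d) (R : realType) (P : probability T R).
Variables (alpha : R) (X : nat -> {RV P >-> R}).
Hypothesis alpha0 : 0 < alpha.
Hypothesis X_indep : mutually_independent P X.
Hypothesis X_pareto : forall (i : nat) (A : set R), measurable A ->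
  distribution P (X i) A = pareto_prob alpha A.

Local Notation m := (alpha / (alpha + 1) ^+ 2).

Let deviation (n : nat) (f : R -> R) (v t : R) : measurable_fun setT f ->
  (forall i, has_mean P (fun w => f (X i w)) 0) ->
  (forall i, has_mean P (fun w => f (X i w) ^+ 2) v) -> (0 < n)%N -> 0 < t ->
  let A := [set w | t * n%:R <= `|\sum_(i < n) f (X i w)|] in
  measurable A /\ fine (P A) <= v / (t ^+ 2 * n%:R).
Proof.
move=> mf mean0 mean2 n0 t0 A.
have nR0 : 0 < n%:R :> R by rewrite ltr0n.
have mS : measurable_fun setT (fun w => \sum_(i < n) f (X i w)).
  by apply: measurable_sum => i; exact: measurableT_comp.
split.
  rewrite -[X in measurable X]setTI; apply: measurable_fun_le => //.
  exact: (measurableT_comp (@normr_measurable _ setT) mS).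
have := has_mean_chebyshev mS (has_mean_sqr_sum X_indep n mf mean0 mean2)
  (mulr_gt0 t0 nR0).
move=> /le_trans; apply; rewrite le_eqVlt; apply/orP; left; apply/eqP.
by field; rewrite !gt_eqF.
Qed.

Lemma linearization_negligible (delta e : R) : 0 < delta -> 0 < e ->
  \forall n \near \oo, fine (P [set w | delta <=
    `|sqrtn_DS1 X n w - (\sum_(i < n) influence alpha (X i w)) / Num.sqrt n%:R|]) <= e.
Proof.
move=> delta0 e0.
have a0 : 0 < alpha + 1 by rewrite addr_gt0.
have m0 : 0 <= m by rewrite divr_ge0 ?exprn_ge0// ltW.
pose c := 2 * alpha * (1 + m); have c0 : 0 < c by rewrite !mulr_gt0// ltr_pwDl.
(* Chosen so that the linearization error is at most [c * eta = delta / 2], strictly below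
   [delta]. *)
pose eta := delta / (2 * c).
have eta0 : 0 < eta by rewrite divr_gt0// mulr_gt0.
pose vq := 2 * alpha / (alpha + 2) ^+ 3 - m ^+ 2.
near=> n.
have n0 : (0 < n)%N by near: n; exact: nbhs_infty_gt.
(* The first bound gives [t ^+ 2 <= 1 / 4] for the [t] below. The second brings the sum
   [(1 + vq) / (eta * r)] of the two Chebyshev bounds below [e], where 1 and [vq] are the variances
   of [log_dev] and [ratio_dev]. *)
have r_ge1 : 4 * eta <= Num.sqrt n%:R by near: n; exact: near_sqrt_ge.
have r_ge2 : (1 + vq) / (eta * e) <= Num.sqrt n%:R.
  by near: n; exact: near_sqrt_ge.
pose r := Num.sqrt (n%:R : R); rewrite -/r in r_ge1 r_ge2.
have r0 : 0 < r by rewrite sqrtr_gt0 ltr0n.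
have nr : n%:R = r ^+ 2 :> R by rewrite sqr_sqrtr.
(* This choice makes the linearization error of order t ^+ 2 * r = eta small,
   while the deviation probabilities are of order (t ^+ 2 * n)^-1. *)
pose t := Num.sqrt (eta / r).
have t0 : 0 < t by rewrite sqrtr_gt0 divr_gt0.
have t2 : t ^+ 2 = eta / r by rewrite sqr_sqrtr// divr_ge0// ltW.
have t12 : 0 <= t <= 1 / 2.
  rewrite (ltW t0)/= -(ler_pXn2r (n := 2)) ?nnegrE ?(ltW t0)// t2.
  by rewrite ler_pdivrMr//; lra.
have [mU PU] := deviation (measurable_log_dev alpha)
  (fun i => log_dev_mean alpha0 (X_pareto i))
  (fun i => log_dev_variance alpha0 (X_pareto i)) n0 t0.
have [mQ PQ] := deviation (measurable_ratio_dev alpha)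
  (fun i => ratio_dev_mean alpha0 (X_pareto i))
  (fun i => ratio_dev_variance alpha0 (X_pareto i)) n0 t0.
pose D w := sqrtn_DS1 X n w - (\sum_(i < n) influence alpha (X i w)) / r.
rewrite -[X in P X]/[set w | delta <= `|D w|].
have mD : measurable_fun setT D.
  apply: measurable_funB; first exact: measurable_sqrtn_DS1.
  apply: measurable_funM => //; apply: measurable_sum => i.
  by apply: measurableT_comp => //; exact: measurable_influence.
have mbad : measurable [set w | delta <= `|D w|].
  rewrite -[X in measurable X]setTI; apply: measurable_fun_le => //.
  exact: (measurableT_comp (@normr_measurable _ setT) mD).
(* The bad event lies in the union of the two deviation events; comparing indicators bounds its
   probability by the sum of theirs. *)
have := has_mean_le (has_mean_indic P mbad)
  (has_meanD (has_mean_indic P mU) (has_mean_indic P mQ)).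
set A := [set w | _ <= `|\sum_(i < n) log_dev _ _|] in mU PU *.
set B := [set w | _ <= `|\sum_(i < n) ratio_dev _ _|] in mQ PQ *.
move=> /(_ _)/le_trans; apply => [w|]; last first.
  apply: (le_trans (lerD PU PQ)); rewrite -mulrDl t2 nr.
  rewrite (_ : eta / r * r ^+ 2 = eta * r); last by field; rewrite gt_eqF.
  move: r_ge2; rewrite (ler_pdivrMr _ _ (mulr_gt0 eta0 e0)) -/vq.
  rewrite (ler_pdivrMr _ _ (mulr_gt0 eta0 r0)).
  by rewrite (_ : r * (eta * e) = e * (eta * r)) //; ring.
rewrite (indic_bool R (fun w => delta <= `|D w|)).
rewrite (indic_bool R (fun w => t * n%:R <= `|\sum_(i < n) log_dev alpha (X i w)|)).
rewrite (indic_bool R (fun w => t * n%:R <= `|\sum_(i < n) ratio_dev alpha (X i w)|)).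
have [_|Ut] := leP (t * n%:R) _.
  by case: (delta <= _)%R; case: (t * n%:R <= _)%R => /=; lra.
have [_|Qt] := leP (t * n%:R) _; first by case: (delta <= _)%R => /=; lra.
have UE : \sum_(i < n) log_dev alpha (X i w) =
    n%:R - alpha * \sum_(i < n) ln (X i w).
  by rewrite /log_dev sumrB -mulr_sumr sumr_const card_ord.
have [L0 err] := linearization_error alpha0 n0 t12 UE (ltW Ut) (ltW Qt).
suff : `|D w| < delta by rewrite ltNge => /negbTE ->; rewrite /= addr0.
rewrite /D /sqrtn_DS1 (sqrtn_DS1_linearization alpha0 n0 L0).
apply: (le_lt_trans err); rewrite -/r t2 divfK ?gt_eqF// -/c /eta.
rewrite (_ : c * _ = delta / 2); last by field; rewrite gt_eqF.
by lra.
Unshelve. all: by end_near. Qed.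

End slutsky.

(* normal_prob takes the standard deviation, hence the square root. *)
Theorem theorem2 (R : realType) (d : measure_display) (T : measurableType d)
    (P : probability T R) (alpha : R) (X : nat -> {RV P >-> R})
    (alpha_gt0 : 0 < alpha)
    (X_indep : mutually_independent P X)
    (X_pareto : forall (i : nat) (A : set R), measurable A ->
       distribution P (X i) A = pareto_prob alpha A) :
  let sigma2 :=
    alpha * (2 + (2 * alpha + alpha ^+ 2) * (5 + 8 * alpha + 4 * alpha ^+ 2)) /
    ((2 + alpha) ^+ 3 * (1 + alpha) ^+ 4) in
  cvg_in_distribution P (fun n : nat => sqrtn_DS1 X n : {RV P >-> R})
    (normal_prob 0 (Num.sqrt sigma2)).
Proof.
apply: (perturbed_clt X_indep (measurable_influence alpha)
  (fun i => influence_mean alpha_gt0 (X_pareto i))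
  (fun i => influence_variance alpha_gt0 (X_pareto i))
  (fun i => influence_third_moment alpha_gt0 (X_pareto i))
  (asymptotic_variance_gt0 alpha_gt0)).
exact: linearization_negligible.
Qed.
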